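(* Let $d\ge2$ and let $(\mathcal{H},w)$, with $\mathcal{H}=\{H_1,\dots,H_n\}$ and $w=(w_1,\dots,w_n)$, be a real PK arrangement in $\mathbb{R}^d$. Then there exists an irreducible Euclidean $\vee$-system $\mathcal{A}=\{\alpha_1,\dots,\alpha_n\}\subset\mathbb{R}^d$ such that (i) the hyperplane arrangement $\Delta_{\mathcal{A}}=\{\alpha_1^\perp,\dots,\alpha_n^\perp\}$ is linearly equivalent to $\mathcal{H}$, i.e. there is $F\in\mathrm{GL}(d,\mathbb{R})$ with $\alpha_i^\perp=F(H_i)$ for all $i$; and (ii) $|\alpha_i|^2=w_i$ for all $i$. Moreover, $\mathcal{A}$ is unique up to orthogonal projective equivalence: if $\mathcal{B}=\{\beta_1,\dots,\beta_n\}$ is another irreducible Euclidean $\vee$-system satisfying (i) and (ii), then there is $G\in\mathrm{O}(d)$ with $\beta_i=\pm G(\alpha_i)$ for all $i$ (the sign depending on $i$).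
   Context: $\mathbb{R}^d$ carries its standard Euclidean inner product $(\cdot,\cdot)$. Euclidean $\vee$-system in $\mathbb{R}^d$: a finite set $\mathcal{A}=\{\alpha_1,\dots,\alpha_n\}\subset\mathbb{R}^d\setminus\{0\}$ of pairwise non-proportional vectors such that: (V1) $\sum_{i=1}^n (x,\alpha_i)^2=|x|^2$ for all $x\in\mathbb{R}^d$; (V2) for every linear $2$-plane $\Pi\subset\mathbb{R}^d$ with $|\mathcal{A}\cap\Pi|\ge 3$ there is $\nu(\Pi)\in\mathbb{R}$ with $\sum_{i:\alpha_i\in\Pi}(x,\alpha_i)^2=\nu(\Pi)|x|^2$ for all $x\in\Pi$; (V3) for every linear $2$-plane $\Pi$ with $\mathcal{A}\cap\Pi=\{\alpha_i,\alpha_j\}$, $i\ne j$, one has $(\alpha_i,\alpha_j)=0$. $\mathcal{A}$ is reducible if there is a non-trivial direct sum decomposition $\mathbb{R}^d=P\oplus P'$ into linear subspaces with $\mathcal{A}=(\mathcal{A}\cap P)\cup(\mathcal{A}\cap P')$; it is irreducible if it is not reducible. Hirzebruch quadratic form: for a finite set $\mathcal{H}=\{H_1,\dots,H_n\}$ of pairwise distinct linear hyperplanes in $\mathbb{R}^d$, let $\mathcal{G}$ be the set of codimension-$2$ linear subspaces $S$ that are the common intersection of $3$ or more hyperplanes in $\mathcal{H}$; let $w_S=\frac12\sum_{i:S\subset H_i}w_i$ for $S\in\mathcal{G}$; and let $\sigma_i$ be the number of $S\in\mathcal{G}$ with $S\subset H_i$. The Hirzebruch quadratic form of $\mathcal{H}$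 is $$Q(w_1,\dots,w_n)=\sum_{S\in\mathcal{G}}w_S^2-\frac12\sum_{i=1}^n(\sigma_i-1)w_i^2-\frac1{2d}\Big(\sum_{i=1}^n w_i\Big)^2 .$$ Real PK arrangement in $\mathbb{R}^d$ ($d\ge2$): a pair $(\mathcal{H},w)$ with $\mathcal{H}=\{H_1,\dots,H_n\}$ a finite set of pairwise distinct linear hyperplanes and $w\in(0,1)^n$ such that: (PK1) $\sum_i w_i=d$; (PK2) for every non-zero proper linear subspace $L\subset\mathbb{R}^d$ that is an intersection of hyperplanes in $\mathcal{H}$, $\sum_{i:L\subset H_i}w_i<d-\dim L$; (PK3) $Q(w)=0$, where $Q$ is the Hirzebruch quadratic form of $\mathcal{H}$. *)

(* Defs.v *)
From mathcomp Require Import all_boot all_order all_algebra.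
From mathcomp Require Import reals.

Set Implicit Arguments.
Unset Strict Implicit.
Unset Printing Implicit Defensive.

Import Order.TTheory GRing.Theory Num.Theory.

Local Open Scope ring_scope.

Definition dot (R : realType) (d : nat) (x y : 'cV[R]_d) : R :=
  (x^T *m y) 0 0.

Definition perp (R : realType) (d : nat) (a : 'cV[R]_d) : {vspace 'cV[R]_d} :=
  lker (linfun (mulmx a^T : 'cV[R]_d -> 'cV[R]_1)).

Lemma memv_perp (R : realType) (d : nat) (a x : 'cV[R]_d) :
  (x \in perp a) = (dot a x == 0).
Proof.
rewrite /perp memv_ker lfunE /= /dot; apply/eqP/eqP => [->|ax0].
  by rewrite mxE.
by apply/matrixP => i j; rewrite !ord1 ax0 mxE.
Qed.

(* A finite set {alpha_1, ..., alpha_n} is given by its enumeration alpha;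
   non-proportionality makes alpha injective, so that summing over indices is
   summing over the set. *)
Record euclidean_vee_system (R : realType) (d n : nat)
    (alpha : 'I_n -> 'cV[R]_d) : Prop := EuclideanVeeSystem {
  vee_neq0 : forall i, alpha i != 0;
  vee_nonproportional : forall i j : 'I_n, i != j ->
    forall c : R, alpha i != c *: alpha j;
  vee_V1 : forall x, \sum_(i < n) dot x (alpha i) ^+ 2 = dot x x;
  vee_V2 : forall Pi : {vspace 'cV[R]_d}, \dim Pi = 2%N ->
    (3 <= #|[set i | alpha i \in Pi]|)%N ->
    exists nu : R, forall x, x \in Pi ->
      \sum_(i < n | alpha i \in Pi) dot x (alpha i) ^+ 2 = nu * dot x x;
  vee_V3 : forall Pi : {vspace 'cV[R]_d}, \dim Pi = 2%N ->
    forall i j : 'I_n, i != j -> [set k | alpha k \in Pi] = [set i; j] ->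
    dot (alpha i) (alpha j) = 0
}.

Definition reducible (R : realType) (d n : nat) (alpha : 'I_n -> 'cV[R]_d) :
    Prop :=
  exists P P' : {vspace 'cV[R]_d},
    [/\ P != 0%VS, P' != 0%VS, (P + P' = fullv)%VS, (P :&: P' = 0)%VS &
        forall i, (alpha i \in P) || (alpha i \in P')].

Definition irreducible (R : realType) (d n : nat) (alpha : 'I_n -> 'cV[R]_d) :
    Prop :=
  ~ reducible alpha.

Definition hyperplane_arrangement (R : realType) (d n : nat)
    (H : 'I_n -> {vspace 'cV[R]_d}) : Prop :=
  injective H /\ forall i, (\dim (H i)).+1 = d.

(* The codimension-2 intersections of at least 3 hyperplanes form a
   duplicate-free list: distinct families of hyperplanes may have the same
   intersection, which is counted once in the Hirzebruch form. *)
Definition codim2_intersections (R : realType) (d n : nat)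
    (H : 'I_n -> {vspace 'cV[R]_d}) : seq {vspace 'cV[R]_d} :=
  undup [seq S <- [seq (\bigcap_(i in J) H i)%VS
                     | J : {set 'I_n} in [pred J : {set 'I_n} | (3 <= #|J|)%N]]
           | (\dim S + 2 == d)%N].

Lemma mem_codim2_intersections (R : realType) (d n : nat)
    (H : 'I_n -> {vspace 'cV[R]_d}) (S : {vspace 'cV[R]_d}) :
  S \in codim2_intersections H <->
  (\dim S + 2 = d)%N /\
  exists2 J : {set 'I_n}, (3 <= #|J|)%N & S = (\bigcap_(i in J) H i)%VS.
Proof.
rewrite mem_undup mem_filter; split.
  by move=> /andP[/eqP dS /imageP[J cJ eS]]; split=> //; exists J.
move=> [dS [J cJ eS]]; rewrite dS eqxx /=; apply/imageP; exists J => //.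
Qed.

Definition half_weight (R : realType) (d n : nat)
    (H : 'I_n -> {vspace 'cV[R]_d}) (w : 'I_n -> R) (S : {vspace 'cV[R]_d}) :
    R :=
  2^-1 * \sum_(i < n | (S <= H i)%VS) w i.

Definition sigma (R : realType) (d n : nat)
    (H : 'I_n -> {vspace 'cV[R]_d}) (i : 'I_n) : nat :=
  count (fun S => (S <= H i)%VS) (codim2_intersections H).

Definition hirzebruch_form (R : realType) (d n : nat)
    (H : 'I_n -> {vspace 'cV[R]_d}) (w : 'I_n -> R) : R :=
  \sum_(S <- codim2_intersections H) half_weight H w S ^+ 2
  - 2^-1 * \sum_(i < n) ((sigma H i)%:R - 1) * w i ^+ 2
  - (2 * d%:R)^-1 * (\sum_(i < n) w i) ^+ 2.

Record real_PK_arrangement (R : realType) (d n : nat)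
    (H : 'I_n -> {vspace 'cV[R]_d}) (w : 'I_n -> R) : Prop :=
  RealPKArrangement {
  PK_arrangement : hyperplane_arrangement H;
  PK_weights : forall i, 0 < w i < 1;
  PK1 : \sum_(i < n) w i = d%:R;
  PK2 : forall L : {vspace 'cV[R]_d}, L != 0%VS -> L != fullv ->
    (exists J : {set 'I_n}, L = (\bigcap_(i in J) H i)%VS) ->
    \sum_(i < n | (L <= H i)%VS) w i < d%:R - (\dim L)%:R;
  PK3 : hirzebruch_form H w = 0
}.

Definition linearly_equivalent (R : realType) (d n : nat)
    (H K : 'I_n -> {vspace 'cV[R]_d}) : Prop :=
  exists2 F : 'M[R]_d, F \in unitmx &
    forall i, K i = (linfun (mulmx F : 'cV[R]_d -> 'cV[R]_d) @: H i)%VS.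

Definition orthogonal_matrix (R : realType) (d : nat) (G : 'M[R]_d) : Prop :=
  G^T *m G = 1%:M.

Definition realizes (R : realType) (d n : nat)
    (H : 'I_n -> {vspace 'cV[R]_d}) (w : 'I_n -> R)
    (alpha : 'I_n -> 'cV[R]_d) : Prop :=
  [/\ euclidean_vee_system alpha, irreducible alpha,
      linearly_equivalent H (fun i => perp (alpha i)) &
      forall i, dot (alpha i) (alpha i) = w i].

(* Main.v *)
Require Import Defs.
From mathcomp Require Import boolp classical_sets topology normedtype.
From mathcomp Require Import sequences derive exp.
From mathcomp Require Import all_boot all_order all_algebra perm.
From mathcomp Require Import reals.
From mathcomp Require Import ring lra zify.

(** The vectors sought are rescaled normals of the hyperplanes, in coordinates
    where they form a tight frame.  Write H_i = a_i^perp.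

    Existence of the coordinates.  The function
      exp (- sum_i w_i t_i) * det (sum_i e^(t_i) a_i a_i^T)
    of t in R^n is invariant under t -> t + c because sum_i w_i = d.  It tends
    to infinity modulo this invariance: the determinant dominates
    prod_(j in B) e^(t_j) for every basis B taken among the a_i, and for a basis
    maximising sum_(j in B) t_j each set {i | t_i >= c} spans the same space as
    its intersection with B.  The strict inequality (PK2), in its dual form
    [PK_stable], then bounds the weight of the set by the number of its basis
    elements, with a uniform gap, and summation over the levels c gives
    [coercive].  At a minimiser, with M M^T = sum_i e^(t_i) a_i a_i^T, the i-th
    partial derivative vanishes exactly when alpha_i = e^(t_i/2) M^-1 a_i has
    square norm w_i ([balanced_factor]); and sum_i alpha_i alpha_i^T = 1, which
    is (V1).

    The conditions on planes.  Taking traces of squares in (V1) gives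
    d = sum_(i,j) (alpha_i, alpha_j)^2.  Each pair i <> j lies in one plane; for
    a plane carrying the indices I, with A = sum_(i in I) alpha_i alpha_i^T,
    tr A^2 >= (tr A)^2 / 2, with equality only if A is a multiple of the
    identity on the plane; for a plane with two vectors the contribution is
    nonnegative and vanishes only if they are orthogonal.  The sum of these
    inequalities says Q(w) <= 0, and Q(w) = 0 forces all the equalities, which
    are (V2) and (V3) ([hirzebruch_zero_vee]).  Irreducibility is (PK2) applied
    to both summands of a decomposition ([PK_irreducible]).

    Uniqueness.  Two solutions are related by beta_i = c_i M alpha_i.  Let J be
    the set of indices at which c_i^2 is maximal.  The Cauchy-Schwarz inequality
    for M alpha_k and M^-T alpha_k, k in J, is an equality, and it shows that
    alpha_k is orthogonal to every alpha_j with j outside J.  Irreducibility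
    leaves J = everything, so that M is a multiple of an orthogonal matrix
    ([frame_unique]). *)

Set Implicit Arguments.
Unset Strict Implicit.
Unset Printing Implicit Defensive.

Import Order.TTheory GRing.Theory Num.Theory.
Import numFieldNormedType.Exports.

Local Open Scope ring_scope.

(** * The inner product and hyperplanes *)

Section Dot.
Variables (R : realType) (d : nat).
Implicit Types (x y z a b : 'cV[R]_d) (M : 'M[R]_d).

Lemma dotE x y : dot x y = \sum_k x k 0 * y k 0.
Proof. by rewrite /dot mxE; apply: eq_bigr => k _; rewrite mxE. Qed.

Lemma dotC x y : dot x y = dot y x.
Proof. by rewrite !dotE; apply: eq_bigr => k _; rewrite mulrC. Qed.

Lemma dotDr x y z : dot x (y + z) = dot x y + dot x z.
Proof. by rewrite /dot mulmxDr mxE. Qed.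

Lemma dotZr c x y : dot x (c *: y) = c * dot x y.
Proof. by rewrite /dot -scalemxAr mxE. Qed.

Lemma dotNr x y : dot x (- y) = - dot x y.
Proof. by rewrite -scaleN1r dotZr mulN1r. Qed.

Lemma dotBr x y z : dot x (y - z) = dot x y - dot x z.
Proof. by rewrite dotDr dotNr. Qed.

Lemma dot0r x : dot x 0 = 0.
Proof. by rewrite /dot mulmx0 mxE. Qed.

Lemma dotDl x y z : dot (x + y) z = dot x z + dot y z.
Proof. by rewrite dotC dotDr !(dotC z). Qed.

Lemma dotZl c x y : dot (c *: x) y = c * dot x y.
Proof. by rewrite dotC dotZr dotC. Qed.

Lemma dotNl x y : dot (- x) y = - dot x y.
Proof. by rewrite dotC dotNr dotC. Qed.

Lemma dotBl x y z : dot (x - y) z = dot x z - dot y z.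
Proof. by rewrite dotDl dotNl. Qed.

Lemma dot0l x : dot 0 x = 0.
Proof. by rewrite dotC dot0r. Qed.

Lemma dot_sumr (I : Type) (r : seq I) (P : pred I) (F : I -> 'cV[R]_d) x :
  dot x (\sum_(i <- r | P i) F i) = \sum_(i <- r | P i) dot x (F i).
Proof. by apply: (big_morph (dot x)); [exact: dotDr | exact: dot0r]. Qed.

Lemma dot_mulmxl M x y : dot (M *m x) y = dot x (M^T *m y).
Proof. by rewrite /dot trmx_mul mulmxA. Qed.

Lemma dot_mulmxr M x y : dot x (M *m y) = dot (M^T *m x) y.
Proof. by rewrite dot_mulmxl trmxK. Qed.

Lemma dot_ge0 x : 0 <= dot x x.
Proof. by rewrite dotE sumr_ge0 // => k _; rewrite -expr2 sqr_ge0. Qed.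

Lemma dot_eq0 x : (dot x x == 0) = (x == 0).
Proof.
apply/eqP/eqP => [|->]; last exact: dot0r.
rewrite dotE => /eqP; rewrite psumr_eq0 => [/allP xk0|k _]; last first.
  by rewrite -expr2 sqr_ge0.
apply/matrixP => k j; rewrite ord1 mxE; apply/eqP.
by have := xk0 k (mem_index_enum _); rewrite mulf_eq0 orbb.
Qed.

Lemma dot_gt0 x : (0 < dot x x) = (x != 0).
Proof. by rewrite lt_def dot_ge0 andbT dot_eq0. Qed.

Lemma cauchy_schwarz x y : dot x y ^+ 2 <= dot x x * dot y y.
Proof.
have [->|x0] := eqVneq x 0; first by rewrite !dot0l expr0n mul0r.
have xx : 0 < dot x x by rewrite dot_gt0.
have := dot_ge0 (dot x x *: y - dot x y *: x).
rewrite !(dotBr, dotBl, dotZl, dotZr) (dotC y x) => h.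
have {}h : 0 <= dot x x * (dot x x * dot y y - dot x y ^+ 2).
  by apply: le_trans h _; rewrite le_eqVlt; apply/orP; left; apply/eqP; ring.
by rewrite pmulr_rge0 // subr_ge0 in h.
Qed.

Lemma perp_neqfull a : a != 0 -> perp a != fullv.
Proof.
move=> a0; apply: contraNneq a0 => pf.
by rewrite -dot_eq0 -memv_perp pf memvf.
Qed.

Lemma perp_sub_line a b : (perp a <= perp b)%VS -> a != 0 ->
  b = (dot a b / dot a a) *: a.
Proof.
move=> ab a0; have aa : dot a a != 0 by rewrite dot_eq0.
set c := _ / _; apply/eqP; rewrite -subr_eq0 -dot_eq0.
have ac : dot a (b - c *: a) = 0 by rewrite dotBr dotZr divfK ?subrr.
have /(subvP ab) : b - c *: a \in perp a by rewrite memv_perp ac.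
rewrite memv_perp => /eqP bc.
by rewrite {1}dotBl dotZl ac bc mulr0 subr0.
Qed.

Lemma dim_cV : \dim (fullv : {vspace 'cV[R]_d}) = d.
Proof. by rewrite dimvf /dim /= muln1. Qed.

(** The normal is read off a linear form with kernel U: a nonzero coordinate of
    the projection onto a complementary line along U. *)
Lemma hyperplane_normal (U : {vspace 'cV[R]_d}) : (\dim U).+1 = d ->
  exists2 a, a != 0 & U = perp a.
Proof.
move=> dU.
have dimf := dim_cV.
have dV : \dim U^C = 1%N by rewrite dimv_compl dimf -{1}dU subSnn.
set V := (U^C)%VS in dV.
have VU0 : (V :&: U = 0)%VS by rewrite capvC capv_compl.
have VUf : (V + U = fullv)%VS by rewrite addvC addv_complf.
pose v := vpick V.
have v0 : v != 0 by rewrite vpick0 -dimv_eq0 dV.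
have Vv : V = <[v]>%VS.
  apply/esym/eqP; rewrite eqEdim -memvE memv_pick dV dim_vline v0 //.
(* The k-th coordinate is injective on the line spanned by v. *)
have [k vk] : exists k, v k 0 != 0.
  apply/existsP; apply: contraNT v0 => /existsPn vk; apply/eqP/matrixP => i j.
  by rewrite ord1 mxE; apply/eqP; rewrite -[_ == _]negbK vk.
pose p := daddv_pi V U.
pose phi x := (p x) k 0.
have phiU x : (phi x == 0) = (x \in U).
  apply/idP/idP => [|xU]; last first.
    have := @daddv_pi_add _ _ V U x VU0; rewrite VUf memvf -/p => /(_ isT).
    rewrite daddv_pi_id // 1?capvC // => /(canRL (addrK _)).
    by rewrite subrr /phi => ->; rewrite mxE.
  have : p x \in V by apply: memv_pi.
  rewrite Vv => /vlineP[c pc]; rewrite /phi pc mxE mulf_eq0 (negPf vk) orbF => c0.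
  have px0 : p x = 0 by rewrite pc (eqP c0) scale0r.
  have := @daddv_pi_add _ _ V U x VU0; rewrite VUf memvf -/p px0 add0r => <- //.
  exact: memv_pi.
pose a : 'cV[R]_d := \col_j phi (delta_mx j 0).
have aphi x : dot a x = phi x.
  rewrite dotE /phi [in RHS](matrix_sum_delta x) !linear_sum /= summxE.
  apply: eq_bigr => j _; rewrite big_ord1 linearZ !mxE mulrC //.
exists a; last by apply/vspaceP => x; rewrite memv_perp aphi phiU.
apply/eqP => a0.
have : (\dim (fullv : {vspace 'cV[R]_d}) <= \dim U)%N.
  apply: dimvS; apply/subvP => x _; by rewrite -phiU -aphi a0 dot0l.
by rewrite dimf -[X in (X <= _)%N]dU ltnn.
Qed.

Lemma dim_bigcap_perp (s : seq 'cV[R]_d) :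
  (d <= \dim (\bigcap_(v <- s) perp v) + size s)%N.
Proof.
have dimf := dim_cV.
elim: s => [|v s IHs]; first by rewrite big_nil addn0 dimf.
rewrite big_cons; set W := (\bigcap_(j <- s) _)%VS in IHs *.
have := dimv_sum_cap (perp v) W.
have : (\dim (perp v + W) <= d)%N.
  by rewrite -[X in (_ <= X)%N]dimf; apply: dimvS; exact: subvf.
have : (d <= \dim (perp v) + 1)%N.
  have := limg_ker_dim (linfun (mulmx v^T : 'cV[R]_d -> 'cV[R]_1)) fullv.
  rewrite capfv dimf -/(perp v) => e.
  rewrite -[X in (X <= _)%N]e leq_add2l; apply: leq_trans (dimvS (subvf _)) _.
  by rewrite dimvf /dim /= muln1.
rewrite /= ; lia.
Qed.

Lemma memv_bigcap_perp (s : seq 'cV[R]_d) x :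
  (x \in \bigcap_(v <- s) perp v)%VS = all (fun v => dot v x == 0) s.
Proof.
elim: s => [|v s IHs]; first by rewrite big_nil memvf.
by rewrite big_cons memv_cap memv_perp IHs.
Qed.

End Dot.

Lemma mem_linearly_equivalent (R : realType) (d n : nat)
    (H K : 'I_n -> {vspace 'cV[R]_d}) (F : 'M[R]_d) : F \in unitmx ->
  (forall i, K i = (linfun (mulmx F : 'cV[R]_d -> 'cV[R]_d) @: H i)%VS) ->
  forall i x, (x \in H i) = (F *m x \in K i).
Proof.
move=> Fu HF i x; rewrite HF; apply/idP/memv_imgP => [xH|[y yH]].
  by exists x => //; rewrite lfunE.
by rewrite lfunE /= => /(can_inj (mulKmx Fu)) ->.
Qed.

Lemma linearly_equivalentP (R : realType) (d n : nat)
    (H K : 'I_n -> {vspace 'cV[R]_d}) (F : 'M[R]_d) : F \in unitmx ->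
  (forall i x, (x \in K i) = (invmx F *m x \in H i)) -> linearly_equivalent H K.
Proof.
move=> Fu KH; exists F => // i; apply/vspaceP => x; rewrite KH.
apply/idP/memv_imgP => [xH|[y yH ->]].
  by exists (invmx F *m x) => //; rewrite lfunE /= mulKVmx.
by rewrite lfunE /= mulKmx.
Qed.

(** * Stability and irreducibility *)

Section Stability.
Variables (R : realType) (d n : nat).
Variables (H : 'I_n -> {vspace 'cV[R]_d}) (w : 'I_n -> R).
Hypothesis HPK : real_PK_arrangement H w.
Variable alpha : 'I_n -> 'cV[R]_d.
Hypothesis Halpha : linearly_equivalent H (fun i => perp (alpha i)).

Lemma weight_gt0 i : 0 < w i.
Proof. by have /andP[] := PK_weights HPK i. Qed.

(** This is (PK2) read on the side of the normals.  The intersection L of the H_i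
    with alpha_i in P has dimension at least d - dim P, because it contains the
    common orthogonal of a basis of P, and it lies in all these H_i. *)
Lemma PK_stable (P : {vspace 'cV[R]_d}) : P != 0%VS -> P != fullv ->
  \sum_(i < n | alpha i \in P) w i < (\dim P)%:R.
Proof.
move=> P0 Pf; have [F Fu HF] := Halpha.
have dimf := dim_cV R d.
have dP : (\dim P < d)%N.
  rewrite ltnNge; apply: contraNN Pf => dP.
  by rewrite eqEdim subvf dimf.
have dP0 : (0 < \dim P)%N by rewrite lt0n dimv_eq0.
have Hf i : H i != fullv.
  by apply/eqP => Hi; have := (PK_arrangement HPK).2 i; rewrite Hi dimf; lia.
pose J := [set i | alpha i \in P].
pose L := (\bigcap_(i in J) H i)%VS.
have dL : (d <= \dim L + \dim P)%N.
  have := dim_bigcap_perp (vbasis P); rewrite size_tuple => /leq_trans; apply.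
  rewrite leq_add2r.
  have lim := limg_dim_eq (f := linfun (mulmx F : 'cV[R]_d -> 'cV[R]_d)) (U := L).
  rewrite -lim; last first.
    apply/eqP; rewrite -subv0; apply/subvP => x; rewrite memv_cap memv_ker lfunE /=.
    by case/andP=> _ /eqP Fx; rewrite memv0 -[x](mulKmx Fu) Fx mulmx0.
  apply: dimvS; apply/subvP => y yb.
  have yE : y = linfun (mulmx F : 'cV[R]_d -> 'cV[R]_d) (invmx F *m y).
    by rewrite lfunE /= mulKVmx.
  rewrite yE; apply: memv_img; rewrite memvE; apply/subv_bigcapP => i.
  rewrite inE -memvE (mem_linearly_equivalent Fu HF) mulKVmx // => aP.
  rewrite memv_perp dotC (coord_vbasis aP) dot_sumr big1 // => k _.
  rewrite dotZr; suff /eqP-> : dot y (vbasis P)`_k == 0 by rewrite mulr0.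
  move: yb; rewrite memv_bigcap_perp => /allP/(_ (vbasis P)`_k).
  by rewrite dotC; apply; rewrite mem_nth // size_tuple.
have L0 : L != 0%VS by rewrite -dimv_eq0 -lt0n; lia.
have [Lf|Lf] := eqVneq L fullv.
  rewrite big_pred0 ?ltr0n // => i; apply/negP => aP.
  have iJ : i \in J by rewrite inE.
  have : (L <= H i)%VS by apply: (bigcapv_inf i).
  by rewrite Lf => fH; have := Hf i; rewrite eqEsubv subvf fH.
have := PK2 HPK L0 Lf (ex_intro _ J erefl) => PK2L.
have : \sum_(i < n | alpha i \in P) w i <= \sum_(i < n | (L <= H i)%VS) w i.
  rewrite big_mkcond [leRHS]big_mkcond /=; apply: ler_sum => i _.
  case: ifP => [aP|_]; last by case: ifP => // _; apply/ltW/weight_gt0.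
  have iJ : i \in J by rewrite inE.
  by rewrite (bigcapv_inf i iJ).
have : d%:R <= (\dim L)%:R + (\dim P)%:R :> R by rewrite -natrD ler_nat.
lra.
Qed.
(** For a decomposition P + P', stability would give
    d = sum_i w_i < dim P + dim P' = d. *)
Lemma PK_irreducible : irreducible alpha.
Proof.
move=> [P [P' [P0 P'0 PPf PP0 cov]]].
have Pf : P != fullv by apply: contraNneq P'0 => Pf; rewrite -PP0 Pf capfv.
have P'f : P' != fullv by apply: contraNneq P0 => Pf'; rewrite -PP0 Pf' capvf.
have := PK_stable P0 Pf; have := PK_stable P'0 P'f.
have : (\dim P)%:R + (\dim P')%:R = d%:R :> R.
  by rewrite -natrD -dimv_disjoint_sum // PPf dim_cV.
have : \sum_(i < n) w i <= \sum_(i < n | alpha i \in P) w i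
                         + \sum_(i < n | alpha i \in P') w i.
  rewrite [X in _ <= X + _]big_mkcond [X in _ <= _ + X]big_mkcond -big_split /=.
  apply: ler_sum => i _; have := weight_gt0 i; have := cov i.
  by do 2![case: ifP => _] => //= _; lra.
rewrite (PK1 HPK); lra.
Qed.
End Stability.

(** * Planes and their orthonormal bases *)

Section Planes.
Variables (R : realType) (d : nat).
Implicit Types (x y z a b e f : 'cV[R]_d).

Lemma normalize x : x != 0 -> exists2 c : R, c != 0 & dot (c *: x) (c *: x) = 1.
Proof.
rewrite -dot_gt0 => xx; exists (Num.sqrt (dot x x))^-1.
  by rewrite invr_eq0 gt_eqF ?sqrtr_gt0.
rewrite dotZl dotZr mulrA -expr2 exprVn sqr_sqrtr ?ltW // mulVf ?gt_eqF //.
Qed.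

Lemma dim_span2 a b : a != 0 -> (forall c : R, b != c *: a) ->
  \dim <<[:: b; a]>> = 2%N.
Proof.
move=> a0 ba; apply/eqP; change (free [:: b; a]).
rewrite free_cons span_seq1 seq1_free a0 andbT.
by apply/negP => /vlineP[c bE]; have := ba c; rewrite bE eqxx.
Qed.

Lemma plane_span (Pi : {vspace 'cV[R]_d}) a b : \dim Pi = 2%N ->
  a != 0 -> (forall c : R, b != c *: a) -> a \in Pi -> b \in Pi ->
  Pi = <<[:: b; a]>>%VS.
Proof.
move=> dPi a0 ba aPi bPi; apply/esym/eqP; rewrite eqEdim dPi dim_span2 // andbT.
by apply/span_subvP => x; rewrite !inE => /orP[]/eqP->.
Qed.

(** One step of the Gram-Schmidt process. *)
Lemma orthonormal_span2 a b : a != 0 -> (forall c : R, b != c *: a) ->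
  exists e f, [/\ e \in <<[:: b; a]>>%VS, f \in <<[:: b; a]>>%VS,
    dot e e = 1, dot f f = 1 & dot e f = 0] /\
    forall x, x \in <<[:: b; a]>>%VS -> x = dot x e *: e + dot x f *: f.
Proof.
move=> a0 ba; have [c c0 e1] := normalize a0.
set e := c *: a in e1.
pose g := b - dot b e *: e.
have g0 : g != 0 by rewrite subr_eq0 /e scalerA; exact: ba.
have eg : dot e g = 0 by rewrite dotBr dotZr e1 mulr1 dotC subrr.
have [c' c'0 f1] := normalize g0; set f := c' *: g in f1.
have eS : e \in <<[:: b; a]>>%VS by rewrite memvZ // memv_span // !inE eqxx orbT.
have fS : f \in <<[:: b; a]>>%VS.
  by rewrite memvZ //; apply: memvB; last exact: memvZ;
     rewrite memv_span // !inE eqxx.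
have ef : dot e f = 0 by rewrite dotZr eg mulr0.
exists e, f; split=> // x; rewrite span_cons span_seq1 => /memv_addP.
case=> _ /vlineP[k ->] [_ /vlineP[l ->] ->].
have aE : a = c^-1 *: e by rewrite scalerA mulVf ?scale1r.
have bE : b = c'^-1 *: f + dot b e *: e.
  by rewrite scalerA mulVf // scale1r subrK.
move: (dot b e) bE => t bE; clear eg eS fS g0; clearbody f; clear g.
clearbody e; rewrite aE bE.
rewrite !(dotDl, dotZl) (dotC f e) e1 f1 ef !scalerDr !scalerA !scalerDl.
apply/matrixP => i j; rewrite !mxE; ring.
Qed.

Lemma orthonormal_coords_dot e f x y :
  x = dot x e *: e + dot x f *: f ->
  dot x y = dot x e * dot y e + dot x f * dot y f.
Proof. by move=> {1}->; rewrite dotDl !dotZl !(dotC y). Qed.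

(** If a^perp and b^perp meet inside z^perp, then the component of z orthogonal to
    the plane of a and b is orthogonal to z as well, hence zero. *)
Lemma perp_capP a b z : a != 0 -> (forall c : R, b != c *: a) ->
  (perp a :&: perp b <= perp z)%VS = (z \in <<[:: b; a]>>%VS).
Proof.
move=> a0 ba; have [e [f [[eS fS e1 f1 ef] dec]]] := orthonormal_span2 a0 ba.
apply/idP/idP => [abz | zS].
  pose g := z - (dot z e *: e + dot z f *: f).
  have eg : dot e g = 0.
    by rewrite /g dotBr dotDr !dotZr e1 ef (dotC e); ring.
  have fg : dot f g = 0.
    by rewrite /g dotBr dotDr !dotZr f1 (dotC f e) ef (dotC f z); ring.
  have orth x : x \in <<[:: b; a]>>%VS -> dot x g = 0.
    by move=> /dec->; rewrite dotDl !dotZl eg fg; ring.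
  have : g \in (perp a :&: perp b)%VS.
    by rewrite memv_cap !memv_perp !orth ?eqxx // memv_span // !inE eqxx ?orbT.
  move=> /(subvP abz); rewrite memv_perp => /eqP zg.
  have : dot g g == 0 by rewrite {1}/g dotBl zg dotDl !dotZl eg fg; apply/eqP; ring.
  rewrite dot_eq0 subr_eq0 => /eqP->.
  by rewrite memvD ?memvZ.
move: zS; rewrite span_cons span_seq1 => /memv_addP.
case=> _ /vlineP[k ->] [_ /vlineP[l ->] ->].
apply/subvP => x; rewrite memv_cap !memv_perp => /andP[/eqP xa /eqP xb].
by rewrite dotDl !dotZl xa xb !mulr0 addr0.
Qed.

End Planes.

Section SquareSum.
Variables (R : realFieldType) (I : finType) (J : pred I) (p q : I -> R).
Let A := \sum_(i | J i) p i ^+ 2.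
Let B := \sum_(i | J i) p i * q i.
Let C := \sum_(i | J i) q i ^+ 2.

(** With p and q the coordinates of vectors in an orthonormal basis of a plane,
    this is tr S^2 = (tr S)^2 / 2 + (a remainder that vanishes only when S is
    scalar) for the 2 x 2 matrix S with rows (A, B) and (B, C). *)
Lemma sum_gram2_sqr :
  \sum_(i | J i) \sum_(j | J j) (p i * p j + q i * q j) ^+ 2
  = 2^-1 * (A + C) ^+ 2 + (2^-1 * (A - C) ^+ 2 + 2 * B ^+ 2).
Proof.
have -> : 2^-1 * (A + C) ^+ 2 + (2^-1 * (A - C) ^+ 2 + 2 * B ^+ 2)
   = A * A + C * C + 2 * (B * B) by field.
rewrite /A /B /C !big_distrlr mulr_sumr -!big_split /=.
apply: eq_bigr => i _; rewrite mulr_sumr -!big_split /=.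
by apply: eq_bigr => j _; ring.
Qed.
End SquareSum.

Section PlaneInequality.
Variables (R : realType) (d n : nat) (alpha : 'I_n -> 'cV[R]_d).
Variables (J : pred 'I_n) (a b : 'cV[R]_d).
Hypotheses (a0 : a != 0) (ba : forall c : R, b != c *: a).
Hypothesis Jspan : forall i, J i -> alpha i \in <<[:: b; a]>>%VS.

(** The amount tr S^2 - (tr S)^2 / 2 for S = sum_(i in J) alpha_i alpha_i^T. *)
Definition plane_defect :=
  \sum_(i | J i) \sum_(j | J j) dot (alpha i) (alpha j) ^+ 2
  - 2^-1 * (\sum_(i | J i) dot (alpha i) (alpha i)) ^+ 2.

(** In orthonormal coordinates the defect is a sum of squares (A - C)^2 / 2 + 2 B^2;
    it vanishes only if A = C and B = 0, that is, if the quadratic form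
    sum_i (x, alpha_i)^2 is A times the norm on the plane. *)
Lemma plane_defect_ge0 : 0 <= plane_defect /\
  (plane_defect = 0 -> exists nu : R, forall x, x \in <<[:: b; a]>>%VS ->
     \sum_(i | J i) dot x (alpha i) ^+ 2 = nu * dot x x).
Proof.
have [e [f [_ dec]]] := orthonormal_span2 a0 ba.
pose p i := dot (alpha i) e; pose q i := dot (alpha i) f.
have dotx x y : x \in <<[:: b; a]>>%VS ->
  dot x y = dot x e * dot y e + dot x f * dot y f.
  by move=> xS; apply/orthonormal_coords_dot/dec.
pose A := \sum_(i | J i) p i ^+ 2; pose C := \sum_(i | J i) q i ^+ 2.
pose B := \sum_(i | J i) p i * q i.
have DE : plane_defect = 2^-1 * (A - C) ^+ 2 + 2 * B ^+ 2.
  rewrite /plane_defect.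
  have -> : \sum_(i | J i) dot (alpha i) (alpha i) = A + C.
    rewrite -big_split; apply: eq_bigr => i Ji /=.
    by rewrite dotx ?Jspan // -!expr2.
  under eq_bigr => i Ji do (under eq_bigr => j Jj do rewrite dotx ?Jspan //).
  rewrite sum_gram2_sqr -/A -/B -/C; ring.
have AC := sqr_ge0 (A - C); have BB := sqr_ge0 B.
split=> [|D0]; first by rewrite DE; lra.
have B0 : B = 0 by apply/eqP; rewrite -sqrf_eq0; apply/eqP; lra.
have AC0 : A - C = 0 by apply/eqP; rewrite -sqrf_eq0; apply/eqP; lra.
exists A => x xS.
transitivity (dot x e ^+ 2 * A + 2 * (dot x e * dot x f) * B + dot x f ^+ 2 * C).
  rewrite !mulr_sumr -!big_split /=; apply: eq_bigr => i Ji.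
  by rewrite (dotx x) // -/(p i) -/(q i); ring.
by rewrite B0 -(subr0_eq AC0) (dotx x x) //; ring.
Qed.

End PlaneInequality.

(** * Vanishing of the Hirzebruch form *)

Section Hirzebruch.
Variables (R : realType) (d n : nat).
Variables (H : 'I_n -> {vspace 'cV[R]_d}) (w : 'I_n -> R).
Hypothesis HA : hyperplane_arrangement H.
Variable alpha : 'I_n -> 'cV[R]_d.
Hypothesis Halpha : linearly_equivalent H (fun i => perp (alpha i)).
Hypothesis alpha0 : forall i, alpha i != 0.

Lemma normals_nonproportional (i j : 'I_n) : i != j ->
  forall c : R, alpha i != c *: alpha j.
Proof.
move=> ij c; apply: contraNneq ij => aE; apply/eqP/HA.1.
have [F Fu HF] := Halpha.
have c0 : c != 0.
  by apply: contraNneq (alpha0 i) => c0; rewrite aE c0 scale0r.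
have : perp (alpha i) = perp (alpha j).
  apply/vspaceP => x; rewrite !memv_perp aE dotZl mulf_eq0 (negPf c0) //.
move=> perp_ij; apply/vspaceP => x.
by rewrite !(mem_linearly_equivalent Fu HF) perp_ij.
Qed.

(** The incidences of the arrangement in codimension two are those of the vectors
    with the planes that they span. *)
Lemma hyperplane_pair_sub (i j k : 'I_n) : i != j ->
  (H i :&: H j <= H k)%VS = (alpha k \in <<[:: alpha j; alpha i]>>%VS).
Proof.
move=> ij; have [F Fu HF] := Halpha.
rewrite -perp_capP //; last by apply: normals_nonproportional; rewrite eq_sym.
have HE := mem_linearly_equivalent Fu HF.
apply/subvP/subvP => sub x; rewrite !memv_cap => xij.
  have := sub (invmx F *m x); rewrite !memv_cap !HE mulKVmx //.
  exact.
by rewrite HE sub // memv_cap -!HE.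
Qed.

Lemma dim_hyperplane_pair (i j : 'I_n) : i != j ->
  (\dim (H i :&: H j) + 2 = d)%N.
Proof.
move=> ij; have [Hinj dH] := HA.
have dimf := dim_cV R d.
have := dimv_sum_cap (H i) (H j).
have le1 := dimvS (subvf (H i + H j)).
have : (\dim (H i :&: H j) < \dim (H i))%N.
  rewrite ltn_neqAle dimvS ?capvSl // andbT; apply: contraNneq ij => e.
  apply/eqP/Hinj/eqP; rewrite eqEdim.
  have -> : \dim (H j) = \dim (H i) by have := dH i; have := dH j; lia.
  rewrite leqnn andbT; apply/capv_idPl/eqP; rewrite eqEdim capvSl e leqnn //.
by rewrite dimf in le1; have := dH i; have := dH j; lia.
Qed.

Let G := codim2_intersections H.

Lemma codim2_eq_pair S (i j : 'I_n) : S \in G -> i != j ->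
  (S <= H i)%VS -> (S <= H j)%VS -> S = (H i :&: H j)%VS.
Proof.
move=> /mem_codim2_intersections[dS _] ij Si Sj; apply/eqP.
rewrite eqEdim subv_cap Si Sj /=; have := dim_hyperplane_pair ij; lia.
Qed.

Lemma codim2_pair S : S \in G ->
  exists i j : 'I_n, [/\ i != j, S = (H i :&: H j)%VS &
    (3 <= #|[set k | (S <= H k)%VS]|)%N].
Proof.
move=> SG; have [dS [J cJ SE]] := (mem_codim2_intersections H S).1 SG.
have SJ i : i \in J -> (S <= H i)%VS by move=> iJ; rewrite SE (bigcapv_inf i).
have [i [j [iJ jJ ij]]] : exists i j, [/\ i \in J, j \in J & i != j].
  have /card_gt1P[i [j [iJ jJ ij]]] : (1 < #|J|)%N by apply: leq_trans cJ.
  by exists i, j.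
exists i, j; split=> //; first by apply: codim2_eq_pair; rewrite ?SJ.
by apply: leq_trans cJ (subset_leq_card _); apply/subsetP => k kJ; rewrite inE SJ.
Qed.

Lemma mem_codim2_pair (i j k : 'I_n) : i != j -> k != i -> k != j ->
  (H i :&: H j <= H k)%VS -> (H i :&: H j)%VS \in G.
Proof.
move=> ij ki kj sub; apply/mem_codim2_intersections.
split; first exact: dim_hyperplane_pair.
exists [set k; i; j]; first by rewrite -setUA cardsU1 cards2 ij !inE negb_or ki kj.
apply/eqP; rewrite eqEsubv; apply/andP; split.
  apply/subv_bigcapP => l; rewrite !inE => /orP[/orP[]|] /eqP -> //.
    exact: capvSl.
  exact: capvSr.
by rewrite subv_cap !(bigcapv_inf _ _ (subvv _)) // !inE eqxx ?orbT.
Qed.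

(** The number of multiple codimension-2 intersections inside both H_i and H_j;
    for i <> j it tells whether the plane of alpha_i and alpha_j carries a third
    vector, and on the diagonal it is sigma_i. *)
Definition pair_count (i j : 'I_n) :=
  count (fun S => (S <= H i)%VS && (S <= H j)%VS) G.

Lemma pair_count_le1 (i j : 'I_n) : i != j -> (pair_count i j <= 1)%N.
Proof.
move=> ij; apply: (@leq_trans (count_mem (H i :&: H j)%VS G)); last first.
  by rewrite count_uniq_mem ?undup_uniq // leq_b1.
have -> : pair_count i j =
    count (fun S => [&& S \in G, (S <= H i)%VS & (S <= H j)%VS]) G.
  by apply: eq_in_count => S ->.
by apply: sub_count => S /= /and3P[SG Si Sj]; apply/eqP/codim2_eq_pair.
Qed.

Lemma sum_pair_count (g : 'I_n -> 'I_n -> R) :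
  \sum_(S <- G) \sum_(i < n | (S <= H i)%VS) \sum_(j < n | (S <= H j)%VS) g i j
  = \sum_(i < n) \sum_(j < n) (pair_count i j)%:R * g i j.
Proof.
transitivity (\sum_(S <- G) \sum_(i < n) \sum_(j < n)
    (if (S <= H i)%VS && (S <= H j)%VS then g i j else 0)).
  apply: eq_bigr => S _; rewrite big_mkcond; apply: eq_bigr => i _.
  by case: ifP => _; [rewrite big_mkcond | rewrite big1].
rewrite exchange_big; apply: eq_bigr => i _ /=.
rewrite exchange_big; apply: eq_bigr => j _ /=.
by rewrite -big_mkcond big_const_seq iter_addr_0 mulr_natl.
Qed.

Hypothesis V1 : forall x, \sum_(i < n) dot x (alpha i) ^+ 2 = dot x x.
Hypothesis norm_alpha : forall i, dot (alpha i) (alpha i) = w i.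
Hypothesis sum_w : \sum_(i < n) w i = d%:R.
Hypothesis Q0 : hirzebruch_form H w = 0.
Hypothesis d_gt0 : (0 < d)%N.

Let g (i j : 'I_n) := dot (alpha i) (alpha j) ^+ 2.
Let D S := plane_defect alpha (fun i => (S <= H i)%VS).

(** The equation Q(w) = 0, rewritten with d = sum_(i,j) (alpha_i, alpha_j)^2 and
    with the double sum distributed over the planes: the defects of the planes
    carrying three or more vectors and the squares (alpha_i, alpha_j)^2 of the
    remaining pairs add up to zero. *)
Lemma sum_defect : \sum_(S <- G) D S
  + \sum_(i < n) \sum_(j < n | j != i) (1 - (pair_count i j)%:R) * g i j = 0.
Proof.
have Sg : \sum_(i < n) \sum_(j < n) g i j = d%:R.
  by rewrite -sum_w; apply: eq_bigr => i _; rewrite V1.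
have gii i : g i i = w i ^+ 2 by rewrite /g norm_alpha.
have SD : \sum_(S <- G) D S
   = \sum_(i < n) \sum_(j < n) (pair_count i j)%:R * g i j
     - 2 * \sum_(S <- G) half_weight H w S ^+ 2.
  rewrite -sum_pair_count mulr_sumr -sumrB; apply: eq_bigr => S _.
  rewrite /D /plane_defect /half_weight /=.
  have -> : \sum_(i < n | (S <= H i)%VS) dot (alpha i) (alpha i)
          = \sum_(i < n | (S <= H i)%VS) w i by apply: eq_bigr.
  by field.
have Sij : \sum_(i < n) \sum_(j < n | j != i) (1 - (pair_count i j)%:R) * g i j
  = \sum_(i < n) \sum_(j < n) g i j
    - \sum_(i < n) \sum_(j < n) (pair_count i j)%:R * g i j
    + \sum_(i < n) ((sigma H i)%:R - 1) * w i ^+ 2.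
  rewrite -sumrB -big_split; apply: eq_bigr => i _ /=.
  rewrite -sumrB [in RHS](bigD1 i) //=.
  have -> : pair_count i i = sigma H i by apply: eq_count => S; rewrite andbb.
  rewrite gii addrAC -[LHS]add0r; congr (_ + _); first by ring.
  by apply: eq_bigr => j _; ring.
have d0 : d%:R != 0 :> R by rewrite pnatr_eq0 -lt0n.
move: Q0; rewrite /hirzebruch_form sum_w Sij SD Sg.
have -> : (2 * d%:R)^-1 * d%:R ^+ 2 = 2^-1 * d%:R :> R by field.
lra.
Qed.

Lemma defect_ge0 S : S \in G -> 0 <= D S.
Proof.
move=> SG; have [i [j [ij SE _]]] := codim2_pair SG.
have Hspan k : (S <= H k)%VS -> alpha k \in <<[:: alpha j; alpha i]>>%VS.
  by rewrite SE hyperplane_pair_sub.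
have ji : forall c, alpha j != c *: alpha i.
  by apply: normals_nonproportional; rewrite eq_sym.
by have [] := plane_defect_ge0 (alpha0 i) ji Hspan.
Qed.

Lemma pair_term_ge0 (i j : 'I_n) : j != i ->
  0 <= (1 - (pair_count i j)%:R) * g i j.
Proof.
move=> ji; rewrite mulr_ge0 ?sqr_ge0 // subr_ge0 lern1.
by rewrite pair_count_le1 // eq_sym.
Qed.

Lemma equality_case :
  (forall S, S \in G -> D S = 0) /\
  (forall i j : 'I_n, j != i -> (1 - (pair_count i j)%:R) * g i j = 0).
Proof.
have h1 : 0 <= \sum_(S <- G) D S.
  by rewrite big_seq sumr_ge0 // => S; exact: defect_ge0.
have t_ge0 i : 0 <= \sum_(j < n | j != i) (1 - (pair_count i j)%:R) * g i j.
  by apply: sumr_ge0 => j; exact: pair_term_ge0.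
have h2 : 0 <= \sum_(i < n) \sum_(j < n | j != i) (1 - (pair_count i j)%:R) * g i j.
  by apply: sumr_ge0.
have /eqP := sum_defect; rewrite paddr_eq0 // => /andP[/eqP e1 /eqP e2]; split.
  move=> S SG; move/eqP: e1; rewrite big_seq psumr_eq0; last exact: defect_ge0.
  by move=> /allP/(_ S SG); rewrite SG => /eqP.
move=> i j ji; apply: (psumr_eq0P (@pair_term_ge0 i) _ ji).
exact: (psumr_eq0P (fun k _ => t_ge0 k) e2 (isT : xpredT i)).
Qed.

(** All terms of [sum_defect] are nonnegative, so each vanishes: vanishing of the
    defects is (V2), vanishing of the remaining pairs is (V3). *)
Lemma hirzebruch_zero_vee : euclidean_vee_system alpha.
Proof.
have [D0 g0] := equality_case.
have np := normals_nonproportional.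
have two (Pi : {vspace 'cV[R]_d}) (i j : 'I_n) : \dim Pi = 2%N -> i != j ->
    alpha i \in Pi -> alpha j \in Pi ->
    forall k, (alpha k \in Pi) = (H i :&: H j <= H k)%VS.
  move=> dPi ij iPi jPi k; rewrite hyperplane_pair_sub //.
  have ji : forall c, alpha j != c *: alpha i by apply: np; rewrite eq_sym.
  by rewrite {1}(plane_span dPi (alpha0 i) ji iPi jPi).
split=> //.
- move=> Pi dPi cPi.
  have /card_gt1P[i [j [+ + ij]]] := ltnW cPi; rewrite !inE => iPi jPi.
  (* A third vector of Pi makes the intersection of H_i and H_j a multiple one. *)
  have [k] : exists k, k \in [set k | alpha k \in Pi] :\: [set i; j].
    apply/set0Pn; rewrite -card_gt0 cardsD subn_gt0.
    apply: leq_trans cPi; rewrite ltnS (leq_trans (subset_leq_card (subsetIr _ _))) //.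
    by rewrite cards2 ij.
  rewrite !inE negb_or => /andP[/andP[ki kj] kPi].
  have SG : (H i :&: H j)%VS \in G.
    by apply: (mem_codim2_pair (k := k)) => //; rewrite -(two Pi i j).
  have ji : forall c, alpha j != c *: alpha i by apply: np; rewrite eq_sym.
  have PiS l : alpha l \in Pi -> alpha l \in <<[:: alpha j; alpha i]>>%VS.
    by rewrite (two _ i j) // hyperplane_pair_sub.
  have [_] := plane_defect_ge0 (alpha0 i) ji PiS.
  rewrite -(plane_span dPi (alpha0 i) ji iPi jPi); apply.
  rewrite -(D0 _ SG) /D /plane_defect.
  rewrite !(eq_bigl _ _ (two Pi i j dPi ij iPi jPi)); congr (_ - _).
  by apply: eq_bigr => l _; rewrite (eq_bigl _ _ (two Pi i j dPi ij iPi jPi)).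
- move=> Pi dPi i j ij PiE.
  have iPi : alpha i \in Pi by have := set21 i j; rewrite -PiE inE.
  have jPi : alpha j \in Pi by have := set22 i j; rewrite -PiE inE.
  have := g0 i j; rewrite eq_sym => /(_ ij).
  suff -> : pair_count i j = 0%N.
    by rewrite subr0 mul1r => /eqP; rewrite sqrf_eq0 => /eqP.
  apply/eqP; rewrite -leqn0 leqNgt -has_count; apply/hasPn => S SG.
  apply/negP => /andP[Si Sj]; have SE := codim2_eq_pair SG ij Si Sj.
  have [_ [_ [_ _]]] := codim2_pair SG.
  suff -> : [set k | (S <= H k)%VS] = [set i; j] by rewrite cards2 ij.
  by rewrite -PiE; apply/setP => k; rewrite !inE SE (two Pi i j).
Qed.

End Hirzebruch.

(** * Uniqueness of tight frames *)

Section Polarization.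
Variables (R : realType) (d : nat).

Lemma dot_separates (x y : 'cV[R]_d) : (forall z, dot z x = dot z y) -> x = y.
Proof.
move=> xy; apply/eqP; rewrite -subr_eq0 -dot_eq0.
by rewrite dotBr !xy subrr.
Qed.

Lemma polarization (A : 'M[R]_d) : A^T = A ->
  (forall x, dot x (A *m x) = dot x x) -> A = 1%:M.
Proof.
move=> symA qA.
have Ax (x : 'cV[R]_d) : A *m x = x.
  apply: dot_separates => z; have := qA (x + z).
  rewrite mulmxDr !(dotDl, dotDr) !qA [dot x (A *m z)]dot_mulmxr symA.
  rewrite (dotC (A *m x)) (dotC x z); lra.
apply/matrixP => i j; have /matrixP/(_ i 0) := Ax (col j 1%:M).
by rewrite colE mul1mx -colE [in LHS]mxE => ->; rewrite !mxE eqxx andbT.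
Qed.
End Polarization.

Section Frame.
Variables (R : realType) (d n : nat) (alpha : 'I_n -> 'cV[R]_d).
Hypothesis V1 : forall x, \sum_(i < n) dot x (alpha i) ^+ 2 = dot x x.

(** The polarized form of (V1): the matrix sum_i alpha_i alpha_i^T is the identity. *)
Lemma frame_expansion x : x = \sum_(i < n) dot x (alpha i) *: alpha i.
Proof.
pose A := \sum_(i < n) alpha i *m (alpha i)^T.
have AE y : A *m y = \sum_(i < n) dot y (alpha i) *: alpha i.
  rewrite mulmx_suml; apply: eq_bigr => i _; rewrite -mulmxA dotC.
  by rewrite [_^T *m y]mx11_scalar mul_mx_scalar.
rewrite -AE (_ : A = 1%:M) ?mul1mx //; apply: polarization => [|y].
  by rewrite /A raddf_sum; apply: eq_bigr => i _; rewrite /= trmx_mul trmxK.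
rewrite AE dot_sumr -V1; apply: eq_bigr => i _.
by rewrite dotZr -expr2.
Qed.

Hypothesis irr : irreducible alpha.
Hypothesis alpha0 : forall i, alpha i != 0.

(** Otherwise the spans of the alpha_i with i in J and with i outside J would
    decompose the space; they generate it by [frame_expansion] and are in direct
    sum because they are orthogonal. *)
Lemma irreducible_orthogonal (J : pred 'I_n) (i0 : 'I_n) : J i0 ->
  (forall i j, J i -> ~~ J j -> dot (alpha i) (alpha j) = 0) ->
  forall i, J i.
Proof.
move=> Ji0 orth i; apply/negPn/negP => nJi; apply: irr.
pose X (K : pred 'I_n) := [seq alpha k | k <- enum 'I_n & K k].
have memX (K : pred 'I_n) k : K k -> alpha k \in <<X K>>%VS.
  by move=> Kk; rewrite memv_span // map_f // mem_filter Kk mem_enum.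
have Xperp (K : pred 'I_n) x y : (forall k, K k -> dot y (alpha k) = 0) ->
    x \in <<X K>>%VS -> dot y x = 0.
  move=> Ky xX; apply/eqP; rewrite -memv_perp; apply: subvP xX.
  apply/span_subvP => v /mapP[k]; rewrite mem_filter => /andP[Kk _] ->.
  by rewrite memv_perp Ky.
have neq0 (K : pred 'I_n) k : K k -> <<X K>>%VS != 0%VS.
  move=> Kk; apply: contraNneq (alpha0 k) => X0.
  by rewrite -memv0 -X0 memX.
exists <<X J>>%VS, <<X (predC J)>>%VS; split.
- exact: neq0 Ji0.
- exact: (neq0 _ i).
- apply/eqP; rewrite eqEsubv subvf; apply/subvP => x _.
  rewrite (frame_expansion x); apply: memv_suml => k _; apply: memvZ.
  have [Jk|Jk] := boolP (J k).
    by apply: subvP (addvSl _ _) _ _; apply: memX.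
  by apply: subvP (addvSr _ _) _ _; apply: memX.
- apply/eqP; rewrite -subv0; apply/subvP => x; rewrite memv_cap => /andP[xJ xJ'].
  rewrite memv0 -dot_eq0 -V1 big1 // => k _.
  suff -> : dot x (alpha k) = 0 by rewrite expr0n.
  rewrite dotC; have [Jk|Jk] := boolP (J k).
    by apply: Xperp xJ' => l Jl; apply: orth.
  by apply: Xperp xJ => l Jl; rewrite dotC; apply: orth.
- move=> k; have [Jk|Jk] := boolP (J k); first by rewrite memX.
  by rewrite [X in _ || X]memX ?orbT.
Qed.

Variables (beta : 'I_n -> 'cV[R]_d) (M : 'M[R]_d) (c : 'I_n -> R).
Hypothesis beta_V1 : forall x, \sum_(i < n) dot x (beta i) ^+ 2 = dot x x.
Hypothesis Mu : M \in unitmx.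
Hypothesis betaE : forall i, beta i = c i *: (M *m alpha i).
Hypothesis norm_beta : forall i, dot (beta i) (beta i) = dot (alpha i) (alpha i).

(** Put N = M^-1 and let g be the maximum of the c_i^2, attained on J.  The frame
    identity for beta reads |N^T y|^2 = sum_i c_i^2 (y, alpha_i)^2 <= g |y|^2.  For
    x = alpha_k with k in J, |M x|^2 = |x|^2 / g, so that
    |x|^4 = (M x, N^T x)^2 <= |M x|^2 |N^T x|^2 forces |N^T x|^2 = g |x|^2, and
    therefore (x, alpha_j) = 0 whenever c_j^2 < g.  By irreducibility all c_i^2
    equal g, and the square root of g times M is orthogonal. *)
Lemma frame_unique : exists2 G : 'M[R]_d, orthogonal_matrix G &
  forall i, beta i = G *m alpha i \/ beta i = - (G *m alpha i).
Proof.
(* An empty frame leaves no sign to determine, and any orthogonal matrix will do. *)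
case: (pickP (fun _ : 'I_n => true)) => [k0 _|no]; last first.
  by exists 1%:M => [|i]; [rewrite /orthogonal_matrix trmx1 mulmx1 | have := no i].
pose N := invmx M.
have NV1 y : dot (N^T *m y) (N^T *m y) = \sum_(i < n) c i ^+ 2 * dot y (alpha i) ^+ 2.
  rewrite -beta_V1; apply: eq_bigr => i _.
  rewrite betaE dotZr -exprMn dot_mulmxl trmxK mulKmx //.
have cM i : c i ^+ 2 * dot (M *m alpha i) (M *m alpha i) = dot (alpha i) (alpha i).
  by rewrite -norm_beta betaE dotZl dotZr mulrA.
have aa i : 0 < dot (alpha i) (alpha i) by rewrite dot_gt0.
have [i0 _ cmax] := @arg_maxP _ _ _ k0 xpredT (fun i => c i ^+ 2) isT.
set g := c i0 ^+ 2 in cmax.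
have {}cmax i : c i ^+ 2 <= g by exact: cmax.
have g_gt0 : 0 < g.
  rewrite lt_def sqr_ge0 andbT; apply/negP => /eqP g0.
  by have := aa i0; rewrite -cM -/g g0 mul0r ltxx.
have call : forall i, c i ^+ 2 == g.
  apply: (@irreducible_orthogonal _ i0); first exact: eqxx.
  move=> k j /eqP ck cj.
  have CS := cauchy_schwarz (M *m alpha k) (N^T *m alpha k).
  rewrite [X in X ^+ 2 <= _]dot_mulmxl mulmxA -trmx_mul mulVmx // trmx1 mul1mx in CS.
  have Nk : g * dot (alpha k) (alpha k) <= dot (N^T *m alpha k) (N^T *m alpha k).
    have gM : g * dot (M *m alpha k) (M *m alpha k) = dot (alpha k) (alpha k).
      by rewrite -ck cM.
    have := ler_wpM2l (ltW g_gt0) CS.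
    by rewrite [X in _ <= X]mulrA gM expr2 mulrCA ler_pM2l.
  have tge0 i : 0 <= (g - c i ^+ 2) * dot (alpha k) (alpha i) ^+ 2.
    by rewrite mulr_ge0 ?sqr_ge0 // subr_ge0 cmax.
  have : \sum_(i < n) (g - c i ^+ 2) * dot (alpha k) (alpha i) ^+ 2 = 0.
    apply/eqP; rewrite eq_le sumr_ge0 // andbT.
    under eq_bigr do rewrite mulrBl.
    by rewrite sumrB -NV1 -mulr_sumr V1 subr_le0.
  move=> /(psumr_eq0P (fun i _ => tge0 i))/(_ j isT)/eqP.
  by rewrite mulf_eq0 subr_eq0 eq_sym (negPf cj) sqrf_eq0 => /eqP.
pose s := Num.sqrt g.
have s2 : s ^+ 2 = g by rewrite sqr_sqrtr // ltW.
have s0 : s != 0 by rewrite -sqrf_eq0 s2 gt_eqF.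
exists (s *: M).
  apply: mulmx1C; apply: polarization => [|x].
    by rewrite trmx_mul trmxK.
  rewrite -mulmxA dot_mulmxr !linearZ /= -!scalemxAl dotZl dotZr mulrA -expr2 s2.
  have := NV1 (M^T *m x); rewrite mulmxA -trmx_mul mulmxV // trmx1 mul1mx => ->.
  under eq_bigr => i _ do rewrite (eqP (call i)).
  by rewrite -mulr_sumr V1.
move=> i; have : (c i / s) ^+ 2 == 1.
  by rewrite expr_div_n s2 (eqP (call i)) divff // gt_eqF.
have bE : beta i = (c i / s) *: (s *: M *m alpha i).
  by rewrite -scalemxAl scalerA divfK // betaE.
rewrite sqrf_eq1 bE => /orP[/eqP->|/eqP->]; first by left; rewrite scale1r.
by right; rewrite scaleN1r.
Qed.

End Frame.

Section Equivalence.
Variables (R : realType) (d n : nat).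
Variables (H : 'I_n -> {vspace 'cV[R]_d}) (alpha beta : 'I_n -> 'cV[R]_d).
Hypothesis Ha : linearly_equivalent H (fun i => perp (alpha i)).
Hypothesis Hb : linearly_equivalent H (fun i => perp (beta i)).
Hypothesis alpha0 : forall i, alpha i != 0.

(** If F and F' carry H_i to alpha_i^perp and beta_i^perp, then F' F^-1 carries
    alpha_i^perp to beta_i^perp, so its inverse transpose carries alpha_i to a
    multiple of beta_i. *)
Lemma equivalent_normals : exists2 M : 'M[R]_d, M \in unitmx &
  exists c : 'I_n -> R, forall i, beta i = c i *: (M *m alpha i).
Proof.
have [F Fu HF] := Ha; have [F' F'u HF'] := Hb.
pose M := (F *m invmx F')^T.
have Mu : M \in unitmx by rewrite unitmx_tr unitmx_mul Fu unitmx_inv.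
exists M => //; exists (fun i => dot (M *m alpha i) (beta i) /
   dot (M *m alpha i) (M *m alpha i)) => i.
apply: perp_sub_line; last first.
  by apply: contraNneq (alpha0 i) => Ma; rewrite -(mulKmx Mu (alpha i)) Ma mulmx0.
apply/subvP => x; rewrite memv_perp dot_mulmxl trmxK -memv_perp.
rewrite -mulmxA -(mem_linearly_equivalent Fu HF).
by rewrite (mem_linearly_equivalent F'u HF') mulKVmx.
Qed.

End Equivalence.

(** * Rank-one updates of positive definite matrices *)

(** Two block triangular factorizations of the same matrix of size 1 + d. *)
Lemma det_1_add_mul (R : comNzRingType) d (u : 'cV[R]_d) (v : 'rV[R]_d) :
  \det (1%:M + u *m v) = 1 + (v *m u) 0 0.
Proof.
pose K := block_mx 1%:M (- v) u 1%:M : 'M_(1 + d).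
have K1 : K = block_mx 1%:M 0 u 1%:M *m block_mx 1%:M (- v) 0 (1%:M + u *m v).
  rewrite mulmx_block !mul1mx !mulmx1 !mul0mx !addr0.
  by rewrite mulmxN addrCA addNr addr0.
have K2 : K = block_mx (1%:M + v *m u) (- v) 0 1%:M *m block_mx 1%:M 0 u 1%:M.
  rewrite mulmx_block !mul1mx !mulmx1 !mul0mx ?mulmx0 !add0r.
  by rewrite mulNmx addrK.
have : \det K = \det K by [].
rewrite {1}K1 K2 !det_mulmx !det_lblock !det_ublock !det1 !mul1r !mulr1 => ->.
by rewrite det_mx11 !mxE eqxx.
Qed.

Section Gram.
Variables (R : realType) (d : nat).
Implicit Types (M X : 'M[R]_d) (a u : 'cV[R]_d).

(** Positive definiteness, recorded by a factor M, so that the coordinate change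
    M^-1 turning X into the identity is at hand. *)
Definition posdef X := exists2 M, M \in unitmx & X = M *m M^T.

Lemma rank1_update M a s : M \in unitmx ->
  M *m M^T + s *: (a *m a^T)
  = M *m (1%:M + s *: (invmx M *m a *m (invmx M *m a)^T)) *m M^T.
Proof.
move=> Mu; rewrite mulmxDr mulmxDl mulmx1 -scalemxAr -scalemxAl; congr (_ + _ *: _).
rewrite trmx_mul !mulmxA mulmxV // mul1mx -(mulmxA _ _ M^T) -(trmx_mul M).
by rewrite mulmxV // trmx1 mulmx1.
Qed.

Lemma det_rank1_update M a s : M \in unitmx ->
  \det (M *m M^T + s *: (a *m a^T))
  = \det (M *m M^T) * (1 + s * dot (invmx M *m a) (invmx M *m a)).
Proof.
move=> Mu; rewrite rank1_update // !det_mulmx mulrAC; congr (_ * _).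
by rewrite scalemxAl det_1_add_mul -scalemxAr mxE.
Qed.

(** With u = M^-1 a the update is M (1 + s u u^T) M^T, and 1 + s u u^T is the square
    of a matrix 1 + c u u^T. *)
Lemma posdef_rank1_update X a s : posdef X -> 0 <= s ->
  posdef (X + s *: (a *m a^T)).
Proof.
move=> [M Mu ->] s_ge0; set u := invmx M *m a.
pose m := dot u u; have m_ge0 : 0 <= m by apply: dot_ge0.
pose r := Num.sqrt (1 + s * m).
have sm_ge0 : 0 <= s * m by rewrite mulr_ge0.
have r2 : r ^+ 2 = 1 + s * m by rewrite sqr_sqrtr //; lra.
have r_ge0 : 0 <= r by apply: sqrtr_ge0.
have r1 : 1 + r != 0 by rewrite gt_eqF //; lra.
(* The nonnegative root of 2 c + c^2 |u|^2 = s, in a form valid for u = 0. *)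
pose c := s / (1 + r).
have c_ge0 : 0 <= c by rewrite divr_ge0 //; lra.
pose E := 1%:M + c *: (u *m u^T).
have ET : E^T = E by rewrite /E linearD /= linearZ /= trmx_mul trmxK trmx1.
have cE : c + c + c * c * m = s.
  have -> : c + c + c * c * m = s * (2 * (1 + r) + s * m) / (1 + r) ^+ 2.
    by rewrite /c; field.
  have -> : s * m = r ^+ 2 - 1 by rewrite r2; ring.
  by field.
exists (M *m E).
  rewrite unitmx_mul Mu unitmxE /E scalemxAl det_1_add_mul -scalemxAr mxE -/(dot u u).
  by rewrite unitfE gt_eqF // -/m; have := mulr_ge0 c_ge0 m_ge0; lra.
rewrite rank1_update // -/u (trmx_mul M) ET !mulmxA; congr (_ *m _).
rewrite -mulmxA; congr (_ *m _).
have uu : u *m u^T *m (u *m u^T) = m *: (u *m u^T).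
  rewrite mulmxA -(mulmxA u) [u^T *m u]mx11_scalar -/(dot u u) -/m.
  by rewrite mul_mx_scalar -scalemxAl.
rewrite /E mulmxDl mul1mx mulmxDr mulmx1 -scalemxAl -scalemxAr uu !scalerA -!addrA.
by rewrite -!scalerDl [c + (c + _)]addrA cE.
Qed.

Lemma posdef_det_gt0 X : posdef X -> 0 < \det X.
Proof.
case=> M Mu ->; rewrite det_mulmx det_tr -expr2 lt_def sqr_ge0 andbT sqrf_eq0.
by rewrite -unitfE -unitmxE.
Qed.

Lemma posdef_sum (I : Type) (r : seq I) (P : pred I) (s : I -> R)
    (a : I -> 'cV[R]_d) X : (forall i, 0 <= s i) -> posdef X ->
  posdef (X + \sum_(i <- r | P i) s i *: (a i *m (a i)^T)) /\
  \det X <= \det (X + \sum_(i <- r | P i) s i *: (a i *m (a i)^T)).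
Proof.
move=> s_ge0 gX; elim: r => [|i r [gY leY]]; first by rewrite big_nil addr0.
rewrite big_cons; case: ifP => // _.
rewrite addrCA addrC; split; first exact: posdef_rank1_update.
have [M Mu YE] := gY; rewrite YE det_rank1_update // -YE.
apply: le_trans leY _; rewrite ler_peMr ?(ltW (posdef_det_gt0 gY)) //.
by rewrite lerDl mulr_ge0 ?dot_ge0.
Qed.

Variables (n : nat) (a : 'I_n -> 'cV[R]_d).

Definition frame_op (s : 'I_n -> R) := \sum_(i < n) s i *: (a i *m (a i)^T).

(** The matrix of a selection of d of the vectors, repetitions being allowed; the
    selection is a basis when this matrix is invertible. *)
Definition cols_mx (b : 'I_n ^ d) : 'M[R]_d := \matrix_(k, j) a (b j) k 0.

Lemma cols_mx_inj (b : 'I_n ^ d) : cols_mx b \in unitmx -> injective b.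
Proof.
move=> bu j k bjk; apply/eqP; apply: contraTT bu => jk.
rewrite unitmxE -det_tr (determinant_alternate jk) ?unitr0 // => l.
by rewrite !mxE bjk.
Qed.

(** The summands indexed by the basis form C D C^T with C the matrix of the basis
    and D diagonal; the remaining rank-one summands only increase the determinant.
    This replaces the expansion of the determinant over all bases by one of its
    terms. *)
Lemma frame_op_posdef (b : 'I_n ^ d) (s : 'I_n -> R) : cols_mx b \in unitmx ->
  (forall i, 0 < s i) ->
  posdef (frame_op s) /\
  (\prod_j s (b j)) * \det (cols_mx b) ^+ 2 <= \det (frame_op s).
Proof.
move=> bu s_gt0.
pose D := diag_mx (\row_j Num.sqrt (s (b j))).
have Du : D \in unitmx.
  rewrite unitmxE det_diag unitfE; apply/prodf_neq0 => j _.
  by rewrite mxE gt_eqF // sqrtr_gt0.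
pose M := cols_mx b *m D.
have Mu : M \in unitmx by rewrite unitmx_mul bu.
have XE : frame_op s = M *m M^T +
    \sum_(i | i \notin b @: setT) s i *: (a i *m (a i)^T).
  rewrite /frame_op (bigID (mem (b @: setT))) /=; congr (_ + _).
  rewrite big_imset /=; last by move=> j k _ _; exact: cols_mx_inj.
  apply/matrixP => k l; rewrite summxE !mxE.
  rewrite big_mkcond; apply: eq_bigr => j _; rewrite inE.
  rewrite /M mul_mx_diag !mxE big_ord1 !mxE mulrACA -expr2 sqr_sqrtr ?ltW //.
  by ring.
have gM : posdef (M *m M^T) by exists M.
have [gX dX] := posdef_sum (index_enum _) (fun i => i \notin b @: setT) a
                  (fun i => ltW (s_gt0 i)) gM.
rewrite XE; split=> //; apply: le_trans dX; rewrite det_mulmx det_tr -expr2.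
rewrite det_mulmx det_diag exprMn mulrC -prodrXl le_eqVlt; apply/orP; left.
apply/eqP; congr (_ * _); apply: eq_bigr => j _.
by rewrite mxE sqr_sqrtr // ltW.
Qed.

End Gram.

(** * Coercivity *)

(** The smallest positive value of a function on a finite set. *)
Lemma uniform_gap (R : realType) (I : finType) (f : I -> R) :
  exists2 e : R, 0 < e & forall i, 0 < f i -> e <= f i.
Proof.
exists (\big[Num.min/1]_(i | 0 < f i) f i).
  by apply: (big_ind (fun e => 0 < e)) => // x y x0 y0; rewrite lt_min x0.
by move=> i fi; apply: bigmin_le_cond.
Qed.

(** Abel summation over the level sets of t, by induction on the number of indices
    where t is not maximal: lowering the top value of t to the second highest
    value changes the sum by the height of the top layer times the sum of x over
    it. *)
Lemma layer_sum_le (R : realType) (I : finType) (x : I -> R) (e : R)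
    (t : I -> R) (p q : I) : 0 <= e -> \sum_i x i = 0 ->
  (forall i, t i <= t p) ->
  (forall c, (exists i, t i < c) -> (exists j, c <= t j) ->
     \sum_(i | c <= t i) x i <= - e) ->
  \sum_i x i * t i <= - e * (t p - t q).
Proof.
move=> e0 x0; have [k] := ubnP #|[set i | (t i < t p)%R]|.
elim: k => // k IHk in t p q * => /ltnSE ck pmax layer.
have [s0|/set0Pn[r0]] := eqVneq [set i | (t i < t p)%R] set0.
  have tp i : t i = t p.
    apply/eqP; rewrite eq_le pmax leNgt; apply/negP => tip.
    by move/setP/(_ i): s0; rewrite !inE tip.
  under eq_bigr do rewrite tp.
  by rewrite -mulr_suml x0 mul0r (tp q) subrr mulr0.
rewrite inE => r0p.
have [r rp rmax] := @arg_maxP _ _ _ r0 (fun i => t i < t p) t r0p.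
have {}rmax i : t i < t p -> t i <= t r by exact: rmax.
(* t r is the second highest value of t. *)
pose t' i := Num.min (t i) (t r).
have t'r : t' r = t r by rewrite /t' minxx.
have IH : \sum_i x i * t' i <= - e * (t' r - t' q).
  apply: IHk.
  - apply: leq_trans ck; apply: proper_card; apply/properP; split.
      apply/subsetP => i; rewrite !inE t'r /t' gt_min ltxx orbF.
      by move=> /lt_trans; apply.
    by exists r; rewrite !inE ?rp // t'r ltxx.
  - by move=> i; rewrite t'r ge_min lexx orbT.
  - move=> c [i ic] [j cj].
    have cr : c <= t r by apply: le_trans cj _; rewrite ge_min lexx orbT.
    rewrite (eq_bigl (fun i => c <= t i)); last first.
      by move=> l; rewrite le_min cr andbT.
    apply: layer; last by exists r.
    exists i; move: ic; rewrite gt_min => /orP[] // rc.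
    by have := le_lt_trans cr rc; rewrite ltxx.
have top : \sum_(i | t p <= t i) x i <= - e.
  by apply: layer; [exists r | exists p].
have -> : \sum_i x i * t i
   = \sum_i x i * t' i + (t p - t r) * \sum_(i | t p <= t i) x i.
  rewrite mulr_sumr [X in _ + X]big_mkcond -big_split; apply: eq_bigr => i _ /=.
  case: ifP => [pi|/negbT]; last first.
    rewrite -ltNge => ip; rewrite addr0 /t' min_l //; exact: rmax.
  have -> : t i = t p by apply/eqP; rewrite eq_le pi pmax.
  have -> : t' i = t r by rewrite /t' min_r // (le_trans (ltW rp)).
  by ring.
have qE : t' q = t q \/ t q = t p.
  have [qp|pq] := ltP (t q) (t p).
    by left; rewrite /t' min_l // rmax.
  by right; apply/eqP; rewrite eq_le pq pmax.
have : (t p - t r) * \sum_(i | t p <= t i) x i <= (t p - t r) * - e.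
  by rewrite ler_wpM2l // subr_ge0 ltW.
rewrite t'r in IH.
have [tq|tq] := qE.
  rewrite tq in IH.
  have -> : - e * (t p - t q) = - e * (t r - t q) + (t p - t r) * - e by ring.
  lra.
have t'q' : t' q = t r by rewrite /t' tq min_r // ltW.
rewrite t'q' subrr mulr0 in IH; rewrite tq subrr mulr0.
have : 0 <= (t p - t r) * e by rewrite mulr_ge0 // subr_ge0 ltW.
lra.
Qed.

Section Coercivity.
Variables (R : realType) (d n : nat) (a : 'I_n -> 'cV[R]_d) (w : 'I_n -> R).
Hypothesis d_gt0 : (0 < d)%N.
Hypothesis a0 : forall i, a i != 0.
Hypothesis w_gt0 : forall i, 0 < w i.
Hypothesis sum_w : \sum_(i < n) w i = d%:R.
Hypothesis stable : forall P : {vspace 'cV[R]_d}, P != 0%VS -> P != fullv ->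
  \sum_(i < n | a i \in P) w i < (\dim P)%:R.

(** Otherwise all a_i lie in v^perp for some v <> 0, and stability of this proper
    subspace would give d = sum_i w_i < d. *)
Lemma exists_basis : exists b : 'I_n ^ d, cols_mx a b \in unitmx.
Proof.
pose A := \matrix_(i < n, k < d) a i k 0.
have [full|] := boolP (row_full A).
  pose b : 'I_n ^ d := [ffun j => fullrankfun full j].
  exists b; rewrite -unitmx_tr -row_full_unit.
  have -> : (cols_mx a b)^T = rowsub (fullrankfun full) A.
    by apply/matrixP => j k; rewrite !mxE ffunE.
  exact: fullrowsub_full.
rewrite -cokermx_eq0 => /matrix0Pn[k0 [j0 v0]].
pose v := col j0 (cokermx A).
have av i : a i \in perp v.
  rewrite memv_perp dotC dotE; have /matrixP/(_ i j0) := mulmx_coker A.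
  rewrite !mxE => Av; apply/eqP; rewrite -[RHS]Av; apply: eq_bigr => k _.
  by rewrite !mxE.
have vn0 : v != 0.
  by apply: contraNneq v0 => /matrixP/(_ k0 0); rewrite !mxE => ->.
have Pf := perp_neqfull vn0.
have [P0|P0] := eqVneq (perp v) 0%VS.
  have : \sum_(i < n) w i = 0.
    by rewrite big1 // => i _; have := a0 i; rewrite -memv0 -P0 av.
  by rewrite sum_w => /eqP; rewrite pnatr_eq0 (gtn_eqF d_gt0).
have := stable P0 Pf; rewrite (eq_bigl xpredT) // sum_w ltr_nat ltnNge.
by rewrite -[X in (_ <= X)%N](dim_cV R d); rewrite dimvS ?subvf.
Qed.

Lemma cols_mx_mul (b : 'I_n ^ d) (u : 'cV[R]_d) :
  cols_mx a b *m u = \sum_j u j 0 *: a (b j).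
Proof.
apply/matrixP => k l; rewrite ord1 summxE !mxE; apply: eq_bigr => j _.
by rewrite !mxE mulrC.
Qed.

Lemma mul_cols_mx (b : 'I_n ^ d) (v : 'rV[R]_d) j :
  (v *m cols_mx a b) 0 j = dot v^T (a (b j)).
Proof. by rewrite dotE mxE; apply: eq_bigr => k _; rewrite !mxE. Qed.

(** Steinitz exchange: a_i may replace the j-th basis vector when its coordinate
    along that vector is nonzero. *)
Lemma basis_exchange (b : 'I_n ^ d) (i : 'I_n) j : cols_mx a b \in unitmx ->
  (invmx (cols_mx a b) *m a i) j 0 != 0 ->
  cols_mx a [ffun k => if k == j then i else b k] \in unitmx.
Proof.
move=> bu uj; set b' := [ffun k => _].
set u := invmx (cols_mx a b) *m a i in uj.
have aiE : a i = \sum_k u k 0 *: a (b k) by rewrite -cols_mx_mul mulKVmx.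
rewrite -row_free_unit; apply: inj_row_free => v vb'.
have vk k : k != j -> dot v^T (a (b k)) = 0.
  by move=> kj; have := mul_cols_mx b' v k; rewrite vb' mxE ffunE (negPf kj).
have vi : dot v^T (a i) = 0.
  by have := mul_cols_mx b' v j; rewrite vb' mxE ffunE eqxx.
have vj : dot v^T (a (b j)) = 0.
  move: vi; rewrite aiE dot_sumr (bigD1 j) //= big1 => [|k kj]; last first.
    by rewrite dotZr vk ?mulr0.
  by rewrite addr0 dotZr => /eqP; rewrite mulf_eq0 (negPf uj) => /eqP.
have : v *m cols_mx a b = 0.
  apply/rowP => k; rewrite mul_cols_mx mxE.
  by have [->|kj] := eqVneq k j; rewrite ?vj ?vk.
by move=> vb; rewrite -(mulmxK bu v) vb mul0mx.
Qed.

(** Otherwise a_i has a nonzero coordinate along some a_(b j) with t (b j) < c, and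
    exchanging the two would give a basis of larger weight. *)
Lemma max_basis_span (t : 'I_n -> R) (b : 'I_n ^ d) : cols_mx a b \in unitmx ->
  (forall b' : 'I_n ^ d, cols_mx a b' \in unitmx ->
     \sum_j t (b' j) <= \sum_j t (b j)) ->
  forall c i, c <= t i ->
    a i \in <<[seq a (b j) | j <- enum 'I_d & (c <= t (b j))%R]>>%VS.
Proof.
move=> bu bmax c i ci.
pose u := invmx (cols_mx a b) *m a i.
have -> : a i = \sum_k u k 0 *: a (b k) by rewrite -cols_mx_mul mulKVmx.
apply: memv_suml => j _.
have [->|uj] := eqVneq (u j 0) 0; first by rewrite scale0r mem0v.
apply: memvZ; apply: memv_span; apply/mapP; exists j => //.
rewrite mem_filter mem_enum andbT.
have := bmax _ (basis_exchange bu uj).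
rewrite [leRHS](bigD1 j) // [leLHS](bigD1 j) //= ffunE eqxx.
under eq_bigr => k kj do rewrite ffunE (negPf kj).
by rewrite lerD2r; apply: le_trans.
Qed.

(** The vectors of the layer lie in the span P of its basis vectors, so stability
    bounds their weight by dim P; when P is the whole space, the weight is less
    than d because some index lies outside the layer. *)
Lemma max_basis_layer (t : 'I_n -> R) (b : 'I_n ^ d) : cols_mx a b \in unitmx ->
  (forall b' : 'I_n ^ d, cols_mx a b' \in unitmx ->
     \sum_j t (b' j) <= \sum_j t (b j)) ->
  forall c, (exists i, t i < c) -> (exists j, c <= t j) ->
  \sum_(i | c <= t i) w i < #|[set j | (c <= t (b j))%R]|%:R.
Proof.
move=> bu bmax c [i0 i0c] [i1 i1c].
set P := <<[seq a (b j) | j <- enum 'I_d & (c <= t (b j))%R]>>%VS.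
have aP i : c <= t i -> a i \in P by exact: max_basis_span.
have dP : (\dim P <= #|[set j | (c <= t (b j))%R]|)%N.
  apply: leq_trans (dim_span _) _; rewrite size_map size_filter -sum1_count.
  by rewrite big_enum_cond sum1dep_card subset_leq_card.
have [Pf|Pf] := eqVneq P fullv.
  have : (d%:R : R) <= #|[set j | (c <= t (b j))%R]|%:R.
    by rewrite ler_nat; apply: leq_trans dP; rewrite Pf dim_cV.
  apply: lt_le_trans; rewrite -sum_w [ltRHS](bigID (fun i => c <= t i)) /=.
  rewrite ltrDl (bigD1 i0) /=; last by rewrite -ltNge.
  by rewrite ltr_pwDl // sumr_ge0 // => i _; exact: ltW.
have P0 : P != 0%VS.
  by apply: contraNneq (a0 i1) => P0; rewrite -memv0 -P0 aP.
apply: lt_le_trans (_ : (\dim P)%:R <= _); last by rewrite ler_nat.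
apply: le_lt_trans (stable P0 Pf).
rewrite big_mkcond [leRHS]big_mkcond; apply: ler_sum => i _.
case: ifP => [/aP->//|_]; case: ifP => // _; exact: ltW.
Qed.

(** [layer_sum_le] for x_i = w_i minus the multiplicity of i in a basis maximising
    sum_j t (b j); the gap e is the same for all t because only finitely many
    pairs of a layer and a number of basis vectors occur. *)
Lemma coercive : exists2 e : R, 0 < e & forall t : 'I_n -> R,
  exists2 b : 'I_n ^ d, cols_mx a b \in unitmx &
    forall p q, \sum_i w i * t i - \sum_j t (b j) <= - e * (t p - t q).
Proof.
have [e e0 egap] := uniform_gap
   (fun Fk : {set 'I_n} * 'I_d.+1 => Fk.2%:R - \sum_(i in Fk.1) w i).
exists e => // t; have [b0 b0u] := exists_basis.
have [b bu bmax] := @arg_maxP _ _ _ b0 (fun b => cols_mx a b \in unitmx)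
  (fun b : 'I_n ^ d => \sum_j t (b j)) b0u.
have {}bmax b' : cols_mx a b' \in unitmx -> \sum_j t (b' j) <= \sum_j t (b j).
  exact: bmax.
exists b => // p q.
pose x i := w i - #|[set j | b j == i]|%:R.
have xsum (K : pred 'I_n) (f : 'I_n -> R) :
   \sum_(i | K i) x i * f i
   = \sum_(i | K i) w i * f i - \sum_(j | K (b j)) f (b j).
  under eq_bigr do rewrite mulrBl.
  rewrite sumrB; congr (_ - _).
  rewrite [RHS](partition_big b K) //=; apply: eq_bigr => i Ki.
  rewrite (eq_bigr (fun=> f i)) => [|j /andP[_ /eqP->] //].
  rewrite sumr_const mulr_natl; congr (_ *+ _).
  apply: eq_card => j; rewrite !inE unfold_in /=.
  by case: eqP => [->|]; rewrite ?Ki // andbF.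
have -> : \sum_i w i * t i - \sum_j t (b j) = \sum_i x i * t i by rewrite xsum.
have [m _ mmax] := @arg_maxP _ _ _ p xpredT t isT.
have {}mmax i : t i <= t m by exact: mmax.
apply: (@le_trans _ _ (- e * (t m - t q))); last first.
  by rewrite !mulNr lerN2 ler_pM2l // lerD2r.
have x0 : \sum_i x i = 0.
  have := xsum xpredT (fun=> 1).
  under eq_bigr do rewrite mulr1.
  move=> ->; under eq_bigr do rewrite mulr1.
  by rewrite sum_w sumr_const card_ord subrr.
apply: (layer_sum_le q (ltW e0) x0 mmax) => c ic jc.
have := xsum (fun i => c <= t i) (fun=> 1).
under eq_bigr do rewrite mulr1.
under [X in _ = X - _]eq_bigr do rewrite mulr1.
move=> ->; rewrite sumr_const.
have := max_basis_layer bu bmax ic jc.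
set N := #|_|; move=> lt.
have Nd : (N < d.+1)%N by rewrite ltnS -[X in (_ <= X)%N]card_ord max_card.
have := egap ([set i | c <= t i], Ordinal Nd) => /=.
have -> : \sum_(i in [set i | c <= t i]) w i = \sum_(i | c <= t i) w i.
  by apply: eq_bigl => i; rewrite inE.
rewrite subr_gt0 => /(_ lt).
have -> : #|(fun j => (c <= t (b j))%R)| = N by apply: eq_card => j; rewrite inE.
lra.
Qed.
End Coercivity.

(** * The minimiser *)

Section ExpInequality.
Variable R : realType.

(** The hypothesis says that h |-> 1 + (e^h - 1) q - e^(w h) is minimal at 0, where its
    derivative is q - w.  Only the inequality 1 + x <= e^x is used: it gives
    e^h - 1 <= h / (1 - h) for 0 < h < 1 and 1 - e^(-h) >= h / (1 + h). *)
Lemma expR_slope (w q : R) : 0 <= q -> 0 <= w ->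
  (forall h, expR (w * h) <= 1 + (expR h - 1) * q) -> w = q.
Proof.
move=> q0 w0 hyp.
have lin h : w * h <= (expR h - 1) * q.
  have := expR_ge1Dx (w * h); have := hyp h; lra.
have up (h : R) : 0 < h -> h < 1 -> w * (1 - h) <= q.
  move=> h0 h1; have eh := expR_gt0 h.
  have : expR h * (1 - h) <= 1.
    rewrite -(ler_pM2l (expR_gt0 (- h))) mulrA -expRD addNr expR0 mul1r mulr1.
    by have := expR_ge1Dx (- h); lra.
  have l := lin h => h2.
  have h3 : w * h * (1 - h) <= (expR h - 1) * q * (1 - h).
    by rewrite ler_wpM2r // subr_ge0 ltW.
  have : w * h * (1 - h) <= h * q.
    apply: le_trans h3 _; rewrite mulrAC ler_wpM2r //; lra.
  by rewrite mulrAC mulrC ler_pM2l.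
have down (h : R) : 0 < h -> q <= w * (1 + h).
  move=> h0.
  have : expR (- h) * (1 + h) <= 1.
    rewrite -(ler_pM2l (expR_gt0 h)) mulrA -expRD subrr expR0 mul1r mulr1.
    exact: expR_ge1Dx.
  have l := lin (- h) => h2.
  have h3 : (1 - expR (- h)) * q * (1 + h) <= w * h * (1 + h).
    by rewrite ler_wpM2r //; lra.
  have : h * q <= w * h * (1 + h).
    apply: le_trans h3; rewrite mulrAC ler_wpM2r //; lra.
  by rewrite -mulrA mulrCA ler_pM2l.
apply/eqP; rewrite eq_le; apply/andP; split; apply/ler_addgt0Pr => e e0.
  have w1 : 0 < w + 1 by lra.
  (* This h keeps the loss w h below e while staying below 1. *)
  pose h := Num.min (e / (w + 1)) 2^-1.
  have h0 : 0 < h by rewrite lt_min divr_gt0 //= invr_gt0.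
  have h1 : h < 1 by rewrite gt_min orbC invf_lt1 // ltr1n.
  have he : h * (w + 1) <= e by rewrite -ler_pdivlMr // ge_min lexx.
  have := up h h0 h1; nra.
have w1 : 0 < w + 1 by lra.
pose h := e / (w + 1).
have h0 : 0 < h by rewrite divr_gt0.
have he : h * (w + 1) = e by rewrite divfK // gt_eqF.
have := down h h0; nra.
Qed.
End ExpInequality.

Section Minimizer.
Variables (R : realType) (d n : nat) (a : 'I_n -> 'cV[R]_d) (w : 'I_n -> R).
Hypothesis d_gt0 : (0 < d)%N.
Hypothesis a0 : forall i, a i != 0.
Hypothesis w_gt0 : forall i, 0 < w i.
Hypothesis sum_w : \sum_(i < n) w i = d%:R.
Hypothesis stable : forall P : {vspace 'cV[R]_d}, P != 0%VS -> P != fullv ->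
  \sum_(i < n | a i \in P) w i < (\dim P)%:R.

(** Its minimisers are the coordinates t for which the rescaled normals, made into
    a tight frame, have the prescribed norms. *)
Definition potential (t : 'I_n -> R) :=
  expR (- \sum_i w i * t i) * \det (frame_op a (fun i => expR (t i))).

Lemma potential_ge : exists2 c : R, 0 < c & exists2 e : R, 0 < e &
  forall t p q, c * expR (e * (t p - t q)) <= potential t.
Proof.
have [e e0 co] := coercive d_gt0 a0 w_gt0 sum_w stable.
have [c c0 cmin] := uniform_gap (fun b : 'I_n ^ d => \det (cols_mx a b) ^+ 2).
exists c => //; exists e => // t p q.
have [b bu bco] := co t.
have [_] := frame_op_posdef (s := fun i => expR (t i)) bu (fun i => expR_gt0 (t i)).
rewrite -expR_sum => dge.
have cb : c <= \det (cols_mx a b) ^+ 2.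
  by apply: cmin; rewrite lt_def sqr_ge0 andbT sqrf_eq0 -unitfE -unitmxE.
rewrite /potential; apply: le_trans (ler_wpM2l (expR_ge0 _) dge).
rewrite mulrA -expRD [leRHS]mulrC; apply: ler_pM (ltW c0) (expR_ge0 _) cb _.
by rewrite ler_expR; have := bco p q; lra.
Qed.

Lemma potential_shift (t : 'I_n -> R) (c : R) :
  potential (fun i => t i + c) = potential t.
Proof.
rewrite /potential.
have -> : \sum_i w i * (t i + c) = \sum_i w i * t i + d%:R * c.
  by rewrite -sum_w mulr_suml -big_split; apply: eq_bigr => i _ /=; rewrite mulrDr.
have -> : frame_op a (fun i => expR (t i + c))
        = expR c *: frame_op a (fun i => expR (t i)).
  rewrite /frame_op scaler_sumr; apply: eq_bigr => i _.
  by rewrite expRD mulrC scalerA.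
rewrite detZ opprD expRD -expRM_natl -mulrA [X in _ * X]mulrA -expRD.
by rewrite addNr expR0 mul1r.
Qed.

Lemma continuous_potential :
  continuous (fun v : 'rV[R]_n => potential (v 0)).
Proof.
have coord i : continuous (fun v : 'rV[R]_n => v 0 i) by exact: coord_continuous.
have cont_add : continuous (fun x : R * R => x.1 + x.2).
  by move=> x; apply: cvgD; [exact: cvg_fst | exact: cvg_snd].
have cont_mul : continuous (fun x : R * R => x.1 * x.2).
  by move=> x; apply: cvgM; [exact: cvg_fst | exact: cvg_snd].
have cont_exp (f : 'rV[R]_n -> R) : continuous f -> continuous (fun v => expR (f v)).
  by move=> cf v; apply: continuous_comp; [exact: cf | exact: continuous_expR].
have cont_M (f g : 'rV[R]_n -> R) : continuous f -> continuous g ->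
    continuous (fun v => f v * g v).
  by move=> cf cg v; exact: (cvgM (cf v) (cg v)).
have cont_cst (c : R) : continuous (fun _ : 'rV[R]_n => c) by exact: cst_continuous.
have cS : continuous (fun v : 'rV[R]_n => \sum_i w i * v 0 i).
  apply: (continuous_big (op := +%R) cont_add) => i _.
  by apply: cont_M; [exact: cont_cst|].
have cD : continuous (fun v : 'rV[R]_n => \det (frame_op a (fun i => expR (v 0 i)))).
  suff cp (s : {perm 'I_d}) : continuous
      (fun v : 'rV[R]_n => \prod_k frame_op a (fun i => expR (v 0 i)) k (s k)).
    apply: (continuous_big (op := +%R) cont_add) => s _.
    by apply: cont_M; [exact: cont_cst | exact: cp].
  apply: (@continuous_big R _ *%R 1 xpredT cont_mul _ _
    (fun k (v : 'rV[R]_n) => frame_op a (fun i => expR (v 0 i)) k (s k))) => k _.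
  have -> : (fun v : 'rV[R]_n => frame_op a (fun i => expR (v 0 i)) k (s k))
       = (fun v => \sum_(i < n) expR (v 0 i) * (a i *m (a i)^T) k (s k)).
    by apply/funext => v; rewrite summxE; apply: eq_bigr => i _; rewrite mxE.
  apply: (continuous_big (op := +%R) cont_add) => i _.
  by apply: cont_M; [exact: cont_exp | exact: cont_cst].
by apply: cont_M cD; apply: cont_exp => v; exact: (cvgN (cS v)).
Qed.

(** By invariance t may be shifted to have maximum 0.  Outside the box [-K, 0]^n the
    lower bound [potential_ge] exceeds the value at 0, so a minimum over this
    compact box is a minimum everywhere. *)
Lemma potential_min : exists t, forall t', potential t <= potential t'.
Proof.
have [c c0 [e e0 lower]] := potential_ge.
(* With this K, c e^(e K) >= c (1 + e K) >= potential 0. *)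
pose K := potential (fun=> 0) / (c * e).
have ce0 : 0 < c * e by rewrite mulr_gt0.
pose A : set 'rV[R]_n := [set v | forall i, `[- K, 0]%classic (v ord0 i)]%classic.
have [i1 _|no] := pickP (fun _ : 'I_n => true); last first.
  have : \sum_(i < n) w i = 0 by rewrite big_pred0.
  by rewrite sum_w => /eqP; rewrite pnatr_eq0 (gtn_eqF d_gt0).
have P0 : 0 <= potential (fun=> 0).
  by apply: le_trans (lower _ i1 i1); rewrite mulr_ge0 ?expR_ge0 ?ltW.
have K0 : 0 <= K by rewrite divr_ge0 // ltW.
have cA : compact A.
  exact: (rV_compact (fun _ : 'I_n => @segment_compact R (- K) 0)).
have A0 : A 0.
  by move=> i; rewrite /= mxE in_itv /= lexx oppr_le0 K0.
have [v vA vmin] := compact_EVT_min (ex_intro _ _ A0) cA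
  (continuous_subspaceT continuous_potential).
exists (v 0) => t.
have [m _ mmax] := @arg_maxP _ _ _ i1 xpredT t isT.
have {}mmax i : t i <= t m by exact: mmax.
pose t' i := t i - t m.
rewrite -(potential_shift t (- t m)) -/t'.
have [/existsP[q qK]|] := boolP [exists q, t' q < - K]; last first.
  rewrite negb_exists => /forallP tK.
  have tA : (\row_i t' i) \in A.
    rewrite in_setE => i /=; rewrite mxE in_itv /= leNgt tK /=.
    by rewrite subr_le0.
  have := vmin _ tA; suff -> : (\row_i t' i) 0 = t' by [].
  by apply/funext => i; rewrite mxE.
have vP : potential (v 0) <= potential (fun=> 0).
  have := vmin 0; rewrite in_setE => /(_ A0).
  suff -> : (0 : 'rV[R]_n) 0 = fun=> 0 by [].
  by apply/funext => i; rewrite mxE.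
apply: le_trans vP (le_trans _ (lower t' m q)).
have PK : potential (fun=> 0) = c * (e * K) by rewrite /K; field; rewrite !gt_eqF.
rewrite PK ler_pM2l //; apply: le_trans (_ : expR (e * K) <= _).
  by have := expR_ge1Dx (e * K); lra.
rewrite ler_expR ler_pM2l // /t' subrr; rewrite /t' in qK; lra.
Qed.

(** The equation is the vanishing of the derivative in the direction of t_i.  A change
    of t_i by h is a rank-one update of the matrix, so the potential is multiplied
    by e^(- w_i h) (1 + (e^h - 1) q) with q the left-hand side, and this factor
    is at least 1 for all h. *)
Lemma balanced_factor : exists (t : 'I_n -> R) (M : 'M[R]_d),
  [/\ M \in unitmx, M *m M^T = frame_op a (fun i => expR (t i)) &
    forall i, expR (t i) * dot (invmx M *m a i) (invmx M *m a i) = w i].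
Proof.
have [t tmin] := potential_min.
have [b bu] := exists_basis d_gt0 a0 sum_w stable.
have [[M Mu XE] _] :=
  frame_op_posdef (s := fun i => expR (t i)) bu (fun i => expR_gt0 (t i)).
exists t, M; split=> // i; symmetry; apply: expR_slope.
- by rewrite mulr_ge0 ?expR_ge0 ?dot_ge0.
- exact: ltW.
move=> h.
pose t' j := if j == i then t i + h else t j.
have wt : \sum_j w j * t' j = \sum_j w j * t j + w i * h.
  rewrite (bigD1 i) //= [in RHS](bigD1 i) //= /t' eqxx.
  rewrite (eq_bigr (fun j => w j * t j)) => [|j /negPf->] //; ring.
have Xt : frame_op a (fun j => expR (t' j)) =
   M *m M^T + (expR (t i) * (expR h - 1)) *: (a i *m (a i)^T).
  rewrite -XE /frame_op (bigD1 i) //= [in RHS](bigD1 i) //= /t' eqxx.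
  rewrite (eq_bigr (fun j => expR (t j) *: (a j *m (a j)^T))) => [|j /negPf->] //.
  rewrite addrAC -scalerDl; congr (_ *: _ + _); rewrite expRD; ring.
have := tmin t'; rewrite /potential wt Xt det_rank1_update // -XE.
rewrite opprD expRD [X in _ <= X]mulrACA -[X in X <= _]mulr1 ler_pM2l; last first.
  by rewrite mulr_gt0 ?expR_gt0 // posdef_det_gt0 //; exists M.
rewrite -(ler_pM2l (expR_gt0 (w i * h))) mulr1 [X in _ <= X]mulrA -expRD subrr.
rewrite expR0 mul1r.
by move/le_trans; apply; rewrite le_eqVlt; apply/orP; left; apply/eqP; ring.
Qed.

End Minimizer.

Lemma frame_op_quad (R : realType) (d n : nat) (a : 'I_n -> 'cV[R]_d)
    (s : 'I_n -> R) x :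
  dot x (frame_op a s *m x) = \sum_(i < n) s i * dot x (a i) ^+ 2.
Proof.
rewrite /frame_op mulmx_suml dot_sumr; apply: eq_bigr => i _.
rewrite -scalemxAl dotZr -mulmxA; congr (_ * _).
by rewrite [(a i)^T *m x]mx11_scalar mul_mx_scalar dotZr -/(dot _ _) dotC expr2.
Qed.

(** * Existence and uniqueness of the realization *)

Section Existence.
Variables (R : realType) (d n : nat).
Variables (H : 'I_n -> {vspace 'cV[R]_d}) (w : 'I_n -> R).
Hypothesis d_gt0 : (0 < d)%N.
Hypothesis HPK : real_PK_arrangement H w.

(** The vectors alpha_i = e^(t_i / 2) M^-1 a_i with t and M from [balanced_factor];
    M^T carries H_i = a_i^perp to alpha_i^perp. *)
Lemma exists_realization : exists alpha, realizes H w alpha.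
Proof.
have HA := PK_arrangement HPK.
have [a a0 HaE] := fin_all_exists2 (fun i => hyperplane_normal (HA.2 i)).
have Ha : linearly_equivalent H (fun i => perp (a i)).
  apply: (linearly_equivalentP (unitmx1 _ _)) => i x.
  by rewrite invmx1 mul1mx HaE.
have [t [M [Mu XE wE]]] := balanced_factor d_gt0 a0 (weight_gt0 HPK) (PK1 HPK)
  (PK_stable HPK Ha).
pose alpha i := expR (t i / 2) *: (invmx M *m a i).
have half i : expR (t i / 2) ^+ 2 = expR (t i).
  by rewrite -expRM_natl; congr expR; field.
have norm_alpha i : dot (alpha i) (alpha i) = w i.
  by rewrite dotZl dotZr mulrA -expr2 half wE.
have alpha0 i : alpha i != 0 by rewrite -dot_gt0 norm_alpha (weight_gt0 HPK).
have V1 x : \sum_(i < n) dot x (alpha i) ^+ 2 = dot x x.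
  pose y := (invmx M)^T *m x.
  have xE : x = M^T *m y by rewrite mulmxA -trmx_mul mulVmx // trmx1 mul1mx.
  rewrite [in RHS]xE dot_mulmxl trmxK mulmxA XE frame_op_quad.
  by apply: eq_bigr => i _; rewrite dotZr exprMn half dot_mulmxr.
have Halpha : linearly_equivalent H (fun i => perp (alpha i)).
  apply: (@linearly_equivalentP _ _ _ _ _ M^T); first by rewrite unitmx_tr.
  move=> i x; rewrite HaE !memv_perp dotZl mulf_eq0 gt_eqF ?expR_gt0 //=.
  by rewrite dot_mulmxl trmx_inv.
exists alpha; split=> //.
  exact: (hirzebruch_zero_vee HA Halpha alpha0 V1 norm_alpha (PK1 HPK) (PK3 HPK)).
exact: (PK_irreducible HPK Halpha).
Qed.

End Existence.

Lemma realization_unique (R : realType) (d n : nat)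
    (H : 'I_n -> {vspace 'cV[R]_d}) (w : 'I_n -> R)
    (alpha beta : 'I_n -> 'cV[R]_d) :
  realizes H w alpha -> realizes H w beta ->
  exists2 G : 'M[R]_d, orthogonal_matrix G &
    forall i, beta i = G *m alpha i \/ beta i = - (G *m alpha i).
Proof.
move=> [Va Ia Ha na] [Vb Ib Hb nb].
have [M Mu [c bE]] := equivalent_normals Ha Hb (vee_neq0 Va).
apply: (frame_unique (vee_V1 Va) Ia (vee_neq0 Va) (vee_V1 Vb) Mu bE).
by move=> i; rewrite na nb.
Qed.

Theorem theorem1p2 (R : realType) (d n : nat) (d_ge2 : (2 <= d)%N)
    (H : 'I_n -> {vspace 'cV[R]_d}) (w : 'I_n -> R)
    (HPK : real_PK_arrangement H w) :
  exists alpha : 'I_n -> 'cV[R]_d,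
    realizes H w alpha /\
    forall beta : 'I_n -> 'cV[R]_d, realizes H w beta ->
      exists2 G : 'M[R]_d, orthogonal_matrix G &
        forall i, beta i = G *m alpha i \/ beta i = - (G *m alpha i).
Proof.
have [alpha Ha] := exists_realization (ltnW d_ge2) HPK.
by exists alpha; split=> // beta; exact: realization_unique.
Qed.
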